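(* Let $n\ge1$, let $r_{ij}>0$ with $r_{ij}=r_{ji}$ for $1\le i\ne j\le3$, and let $0<p_1,p_2,p_3<\infty$. Then there is a finite constant $C_{p_j,r_{ij},n}$ such that $$\prod_{j=1}^3\|f_j\|_{p_j}\le C_{p_j,r_{ij},n}\,\sup_{y_1,y_2,y_3}\ \prod_{j=1}^3f_j(y_j)\prod_{1\le i<j\le3}|y_i-y_j|^{r_{ij}}$$ holds for all nonnegative measurable functions $f_1,f_2,f_3$ on $\mathbb{R}^n$, if and only if $$\sum_{j=1}^3\frac1{p_j}=\frac1n\,(r_{12}+r_{13}+r_{23})\quad\text{and}\quad\frac1{p_j}<\frac1n\sum_{i\ne j}r_{ij}\ \text{ for every } j\in\{1,2,3\}.$$
   Context: $\|f\|_p=(\int_{\mathbb{R}^n}|f|^p\,dx)^{1/p}\in[0,\infty]$ with respect to Lebesgue measure (also for $p<1$), with the usual convention $0\cdot\infty=0$ in products. $\sup$ denotes the essential supremum with respect to Lebesgue measure on $(\mathbb{R}^n)^3$. In $\sum_{i\neq j}r_{ij}$, $j$ is fixed and the sum is over $i\in\{1,2,3\}\setminus\{j\}$. *)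

(* Defs.v *)
From HB Require Import structures.
From mathcomp Require Import all_boot all_order all_algebra.
From mathcomp Require Import all_classical all_reals all_analysis ess_sup_inf.

Set Implicit Arguments.
Unset Strict Implicit.
Unset Printing Implicit Defensive.

Import Order.TTheory GRing.Theory Num.Theory.
Import numFieldNormedType.Exports.

Local Open Scope classical_set_scope.
Local Open Scope ring_scope.

Definition consp (T : Type) (n : nat) (x : T * n.-tuple T) : n.+1.-tuple T :=
  [tuple of x.1 :: x.2].

Lemma measurable_consp d (T : measurableType d) (n : nat) :
  measurable_fun [set: T * n.-tuple T] (@consp T n).
Proof. exact: measurable_cons. Qed.

Section borel_lebesgue.
Context {R : realType}.
Local Open Scope ereal_scope.

Definition lebesgue_cons (n : nat)
    (m : set (n.-tuple (measurableTypeR R)) -> \bar R) :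
    set (n.+1.-tuple (measurableTypeR R)) -> \bar R :=
  pushforward (lebesgue_measure \x m) (@consp (measurableTypeR R) n).

(* The n-fold product of [lebesgue_measure], on the Borel sets of R^n. *)
Fixpoint borel_lebesgue (n : nat) : set (n.-tuple (measurableTypeR R)) -> \bar R :=
  match n with
  | 0 => \d_([tuple] : 0.-tuple (measurableTypeR R))
  | m.+1 => lebesgue_cons (@borel_lebesgue m)
  end.

Lemma sigma_finite_product d1 d2 (T1 : measurableType d1)
    (T2 : measurableType d2)
    (m1 : {sigma_finite_measure set T1 -> \bar R})
    (m2 : {sigma_finite_measure set T2 -> \bar R}) :
  sigma_finite setT (m1 \x m2).
Proof.
have /sigma_finiteP[F [TF ndF Foo]] := sigma_finiteT m1.
have /sigma_finiteP[G [TG ndG Goo]] := sigma_finiteT m2.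
exists (fun n => F n `*` G n).
  rewrite -setXTT TF TG predeqE => -[x y]; split.
    move=> [/= [n _ Fnx] [k _ Gky]]; exists (maxn n k) => //; split.
    - by move: x Fnx; exact/subsetPset/ndF/leq_maxl.
    - by move: y Gky; exact/subsetPset/ndG/leq_maxr.
  by move=> [n _ []/= ? ?]; split; exists n.
move=> k; have [? ?] := Foo k; have [? ?] := Goo k.
split; first exact: measurableX.
by rewrite product_measure1E// lte_mul_pinfty// ge0_fin_numE.
Qed.

Lemma sigma_finite_lebesgue_cons (n : nat)
    (m : {sigma_finite_measure set (n.-tuple (measurableTypeR R)) -> \bar R}) :
  sigma_finite setT (lebesgue_cons m).
Proof.
pose uncons (t : n.+1.-tuple (measurableTypeR R)) :=
  (thead t, [tuple of behead t]).
have muncons : measurable_fun setT uncons.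
  apply/measurable_fun_pair; last exact: measurable_behead.
  exact: measurable_tnth.
have unconsK x : uncons (consp x) = x.
  by case: x => a t; congr pair; apply: val_inj.
have [F TF mF] := sigma_finite_product (@lebesgue_measure R) m.
exists (fun k => uncons @^-1` F k); first by rewrite -preimage_bigcup -TF.
move=> k; split.
  by rewrite -[X in measurable X]setTI; apply: muncons => //; exact: (mF k).1.
rewrite /lebesgue_cons /pushforward -comp_preimage (_ : uncons \o _ = id) ?preimage_id.
  exact: (mF k).2.
by apply/funext => x; exact: unconsK.
Qed.

HB.instance Definition _ (n : nat)
    (m : {sigma_finite_measure set (n.-tuple (measurableTypeR R)) -> \bar R}) :=
  Measure.copy (lebesgue_cons m)
    (measure_function_pushforward__canonical__measure_function_Measure
      (lebesgue_measure \x m) (@measurable_consp _ (measurableTypeR R) n)).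

HB.instance Definition _ (n : nat)
    (m : {sigma_finite_measure set (n.-tuple (measurableTypeR R)) -> \bar R}) :=
  Measure_isSigmaFinite.Build _ _ _ (lebesgue_cons m)
    (sigma_finite_lebesgue_cons m).

Let borel_lebesgue_ex (n : nat) :
  exists m : {sigma_finite_measure set (n.-tuple (measurableTypeR R)) -> \bar R},
    m = @borel_lebesgue n :> (set _ -> \bar R).
Proof.
elim: n => [|n [m mE]].
  by exists (\d_([tuple] : 0.-tuple (measurableTypeR R))).
exists (lebesgue_cons m : {sigma_finite_measure set _ -> \bar R}).
by rewrite /= -mE.
Qed.

Let borel_lebesgue0 (n : nat) : @borel_lebesgue n set0 = 0.
Proof. by have [m <-] := borel_lebesgue_ex n; exact: measure0. Qed.

Let borel_lebesgue_ge0 (n : nat) A : 0 <= @borel_lebesgue n A.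
Proof. by have [m <-] := borel_lebesgue_ex n; exact: measure_ge0. Qed.

Let borel_lebesgue_sigma_additive (n : nat) :
  semi_sigma_additive (@borel_lebesgue n).
Proof.
by have [m <-] := borel_lebesgue_ex n; exact: measure_semi_sigma_additive.
Qed.

HB.instance Definition _ (n : nat) := isMeasure.Build _ _ _ (@borel_lebesgue n)
  (@borel_lebesgue0 n) (@borel_lebesgue_ge0 n)
  (@borel_lebesgue_sigma_additive n).

Lemma borel_lebesgue_sigma_finite (n : nat) :
  sigma_finite setT (@borel_lebesgue n).
Proof. by have [m <-] := borel_lebesgue_ex n; exact: sigma_finiteT. Qed.

HB.instance Definition _ (n : nat) :=
  Measure_isSigmaFinite.Build _ _ _ (@borel_lebesgue n)
    (@borel_lebesgue_sigma_finite n).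

End borel_lebesgue.

(* R^n with its Lebesgue measurable sets, obtained like those of
   [completed_lebesgue_measure] by Caratheodory's criterion. *)
Definition euclidean (R : realType) (n : nat) :=
  caratheodory_type ((@borel_lebesgue R n)^*)%mu.
HB.instance Definition _ (R : realType) (n : nat) :=
  Measurable.on (euclidean R n).

Definition lebesgue_euclidean (R : realType) (n : nat) :
    set (euclidean R n) -> \bar R :=
  @completed_measure_extension _ _ _ (@borel_lebesgue R n).
HB.instance Definition _ (R : realType) (n : nat) :=
  Measure.on (@lebesgue_euclidean R n).
HB.instance Definition _ (R : realType) (n : nat) :=
  Measure_isSigmaFinite.Build _ _ _ (@lebesgue_euclidean R n)
    (completed_measure_extension_sigma_finite
      (@borel_lebesgue_sigma_finite R n)).
Arguments lebesgue_euclidean : clear implicits.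

Definition euclidean_dist (R : realType) (n : nat) (x y : euclidean R n) : R :=
  Num.sqrt (\sum_(k < n) (tnth x k - tnth y k) ^+ 2).

(* The product is taken with its product sigma-algebra, which is smaller than
   that of the Lebesgue measurable sets of (R^n)^3; both have the same
   negligible sets, hence the same essential suprema. *)
Definition lebesgue_euclidean3 (R : realType) (n : nat) :
    set (euclidean R n * euclidean R n * euclidean R n) -> \bar R :=
  ((lebesgue_euclidean R n \x lebesgue_euclidean R n)
    \x lebesgue_euclidean R n)%E.
HB.instance Definition _ (R : realType) (n : nat) :=
  Measure.on (@lebesgue_euclidean3 R n).
Arguments lebesgue_euclidean3 : clear implicits.

Definition proj3 (T : Type) (y : T * T * T) (j : 'I_3) : T :=
  tnth [tuple y.1.1; y.1.2; y.2] j.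

(* Main.v *)
From HB Require Import structures.
Require Import Defs.
From mathcomp Require Import all_boot all_order all_algebra.
From mathcomp Require Import all_classical all_reals all_analysis ess_sup_inf.
From mathcomp Require Import measurable_realfun.
From mathcomp Require Import ring lra.

Set Implicit Arguments.
Unset Strict Implicit.
Unset Printing Implicit Defensive.

Import Order.TTheory GRing.Theory Num.Theory.
Import numFieldNormedType.Exports.

Local Open Scope classical_set_scope.
Local Open Scope ring_scope.

(** Write x_j = 1/p_j, alpha_ij = r_ij/n, a_j for the sum of the alpha_ij over
    i <> j, and sigma = alpha_12 + alpha_13 + alpha_23.

    Sufficiency.  If three sets F_j have finite measures v_j > 0, a union bound
    yields points y_j in F_j whose mutual distances satisfy
    |y_i - y_j|^n >= c max(v_i, v_j) for all three pairs at once: for each pair,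
    the triples violating this fill at most a quarter of F_1 x F_2 x F_3
    ([separated_triple]).  Applied to subsets of the superlevel sets {f_j >= t_j},
    this bounds t_1 t_2 t_3 times the product of the max(v_i, v_j)^alpha_ij by a
    multiple of the supremum A.  That product dominates the product of the
    v_j^x_j whenever 0 <= x_j <= a_j and the x_j add up to sigma
    ([prod_powR_max_ge]).  Hence a weak-type inequality: the product of the weak
    norms sup_t t |{f_j >= t}|^x_j is at most C A ([weak_triple], [sup3_le]).

    The hypotheses say that (1/p_1, 1/p_2, 1/p_3) is interior to this polytope
    relatively to the plane x_1 + x_2 + x_3 = sigma, so that for a small e the
    weak inequality also holds at the three points obtained by adding 2e to one
    of the 1/p_j and subtracting e from the two others.  Their barycentre is
    (1/p_1, 1/p_2, 1/p_3), and an L^p norm is controlled by the geometric mean,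
    with weights 1/3 and 2/3, of the weak norms at 1/p + 2e and 1/p - e
    ([Lnorm_le_weak]).  Multiplying the three weak inequalities and extracting a
    cube root gives the strong one ([prod_Lnorm_le]).

    Necessity.  Indicators of the cube of side l give l^(n (x_1+x_2+x_3)) <=
    C l^(n sigma) for every l > 0, which forces the sum condition
    ([sup_controls_sum]).  If x_1 >= a_1, let f_2 and f_3 be the indicator of the
    unit cube, and let f_1 behave like |y|^(-n x_1) up to a large radius.  The
    supremum stays bounded, since the distances contribute at most |y|^(n a_1),
    while the p_1-th power of the norm of f_1 grows like the number of dyadic
    scales used ([sup_controls_lt]). *)

(** * Cubes and distances in Euclidean space *)

Definition cube {R : realType} {n : nat} (c : 'I_n -> R) (l : R) :
    set (euclidean R n) :=
  [set x | forall k, c k <= tnth x k <= c k + l].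

Lemma measurable_euclidean (R : realType) (n : nat)
    (A : set (n.-tuple (measurableTypeR R))) :
  measurable A -> measurable (A : set (euclidean R n)).
Proof. by move=> mA; apply: sub_caratheodory; exact: sub_sigma_algebra. Qed.

Lemma lebesgue_euclideanE (R : realType) (n : nat)
    (A : set (n.-tuple (measurableTypeR R))) :
  measurable A -> lebesgue_euclidean R n A = borel_lebesgue A.
Proof. exact: measurable_mu_extE. Qed.

Lemma measurable_tnth_euclidean (R : realType) (n : nat) (k : 'I_n) :
  measurable_fun setT ((fun x => tnth x k) : euclidean R n -> R).
Proof.
move=> _ A mA; apply: measurable_euclidean.
exact: (@measurable_tnth _ (measurableTypeR R) n k measurableT A mA).
Qed.

Lemma measurable_borel_cube (R : realType) (n : nat) (c : 'I_n -> R) (l : R) :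
  measurable (cube c l : set (n.-tuple (measurableTypeR R))).
Proof.
have -> : (cube c l : set (n.-tuple (measurableTypeR R))) =
    \bigcap_(k in [set: 'I_n]) ((fun x => tnth x k) @^-1` `[c k, c k + l]).
  apply/seteqP; split => x /= cx k; first by move=> _; rewrite /= in_itv; exact: cx.
  by have := cx k I; rewrite /= in_itv.
apply: fin_bigcap_measurable; first exact: finite_finset.
move=> k _; rewrite -[X in measurable X]setTI.
exact: measurable_tnth.
Qed.

Lemma measurable_cube (R : realType) (n : nat) (c : 'I_n -> R) (l : R) :
  measurable (cube c l).
Proof. by apply: measurable_euclidean; exact: measurable_borel_cube. Qed.

Lemma lebesgue_cube (R : realType) (n : nat) (c : 'I_n -> R) (l : R) :
  0 <= l -> lebesgue_euclidean R n (cube c l) = (l ^+ n)%:E.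
Proof.
move=> l0; rewrite lebesgue_euclideanE; last exact: measurable_borel_cube.
elim: n c => [|n IHn] c.
  rewrite /= diracE expr0 mem_set// => k.
  by case: k.
rewrite /= /lebesgue_cons /pushforward.
have -> : @consp (measurableTypeR R) n @^-1` (cube c l) =
    `[c ord0, c ord0 + l] `*` (cube (c \o lift ord0) l : set (n.-tuple (measurableTypeR R))).
  apply/seteqP; split => -[a t] /=.
    move=> ct; split => /=; first by rewrite in_itv /=; exact: ct ord0.
    by move=> k; have := ct (lift ord0 k); rewrite tnthS.
  rewrite in_itv /= => -[a1 ct] k.
  by case: (unliftP ord0 k) => [j ->|->] //; rewrite tnthS; exact: ct.
rewrite product_measure1E//; last exact: measurable_borel_cube.
rewrite [X in (_ * X)%E](_ : _ = (l ^+ n)%:E); last exact: IHn.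
rewrite [X in (X * _)%E](_ : _ = l%:E); last first.
  transitivity (@lebesgue_measure R `[c ord0, c ord0 + l]) => //.
  rewrite lebesgue_measure_itv /= lte_fin ltrDl lt_def l0 andbT -EFinB addrC addKr.
  by case: eqVneq => //= ->.
by rewrite -EFinM exprS.
Qed.

Lemma measurable_euclidean_dist (R : realType) (n : nat) :
  measurable_fun setT
    (fun z : euclidean R n * euclidean R n => euclidean_dist z.1 z.2).
Proof.
apply: (@measurableT_comp _ _ _ _ _ _ (@Num.sqrt R)).
  apply: continuous_measurable_fun; exact: sqrt_continuous.
apply: measurable_sum => k; apply: measurable_funX.
apply: measurable_funB.
- exact: (measurableT_comp (measurable_tnth_euclidean k) measurable_fst).
- exact: (measurableT_comp (measurable_tnth_euclidean k) measurable_snd).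
Qed.

Lemma euclidean_dist_ge0 (R : realType) (n : nat) (x y : euclidean R n) :
  0 <= euclidean_dist x y.
Proof. exact: sqrtr_ge0. Qed.

Lemma euclidean_distC (R : realType) (n : nat) (x y : euclidean R n) :
  euclidean_dist x y = euclidean_dist y x.
Proof.
congr Num.sqrt; apply: eq_bigr => k _.
by rewrite -[X in X ^+ 2]opprB sqrrN.
Qed.

Lemma ler_tnth_euclidean_dist (R : realType) (n : nat) (x y : euclidean R n)
    (k : 'I_n) :
  `|tnth x k - tnth y k| <= euclidean_dist x y.
Proof.
rewrite -sqrtr_sqr ler_wsqrtr// (bigD1 k)//= lerDl.
by apply: sumr_ge0 => i _; exact: sqr_ge0.
Qed.

Lemma euclidean_dist_le (R : realType) (n : nat) (x y : euclidean R n) (M : R) :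
  0 <= M -> (forall k, `|tnth x k - tnth y k| <= M) ->
  euclidean_dist x y <= Num.sqrt n%:R * M.
Proof.
move=> M0 xyM; rewrite -[X in _ * X]ger0_norm// -sqrtr_sqr -sqrtrM//.
rewrite ler_wsqrtr// mulr_natl -[n in _ *+ n]card_ord -sumr_const.
apply: ler_sum => k _; rewrite -[leLHS]real_normK ?num_real//.
by rewrite lerXn2r ?nnegrE.
Qed.

(** A ball lies in the concentric cube of side twice its radius. *)
Lemma lebesgue_ball_le (R : realType) (n : nat) (x : euclidean R n) (l : R)
    (B : set (euclidean R n)) :
  0 <= l -> measurable B -> (forall y, B y -> euclidean_dist x y <= l) ->
  (lebesgue_euclidean R n B <= ((2 * l) ^+ n)%:E)%E.
Proof.
move=> l0 mB Bl.
rewrite -(@lebesgue_cube R n (fun k => tnth x k - l)) ?mulr_ge0//.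
apply: le_measure; rewrite ?inE//; first exact: measurable_cube.
move=> y /Bl yl k; have := le_trans (ler_tnth_euclidean_dist x y k) yl.
rewrite ler_norml => /andP[]; lra.
Qed.

(** * Separated points in three sets of finite measure *)

Section product_sections.
Local Open Scope ereal_scope.
Context d1 d2 (T1 : measurableType d1) (T2 : measurableType d2) (R : realType).
Variables (m1 : {sigma_finite_measure set T1 -> \bar R})
          (m2 : {sigma_finite_measure set T2 -> \bar R}).

(** The product measure under a name of its own, able to carry the canonical
    structure of sigma-finiteness: on [m1 \x m2] itself that place is already
    taken by the structures of probability measures. *)
Definition sigma_finite_prod : set (T1 * T2) -> \bar R := m1 \x m2.
HB.instance Definition _ := Measure.on sigma_finite_prod.
HB.instance Definition _ := Measure_isSigmaFinite.Build _ _ _ sigma_finite_prod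
  (sigma_finite_product m1 m2).

Lemma product_measure_le_xsection (F : set T1) (B : set (T1 * T2)) (b : \bar R) :
  measurable F -> measurable B -> 0 <= b ->
  (forall x y, B (x, y) -> F x) ->
  (forall x, F x -> m2 (xsection B x) <= b) ->
  (m1 \x m2) B <= m1 F * b.
Proof.
move=> mF mB b0 BF Bb.
have -> : m1 F * b = \int[m1]_x (b * (\1_F x)%:E).
  rewrite muleC ge0_integralZl ?integral_indic ?setIT//.
  exact: measurableT_comp.
apply: ge0_le_integral => //=.
- exact: measurable_fun_xsection.
- apply: emeasurable_funM => //; exact: measurableT_comp.
move=> x _; rewrite indicE; have [/set_mem/Bb|Fx] := boolP (x \in F).
  by rewrite mule1.
rewrite mule0 (_ : xsection B x = set0) ?measure0//.
by rewrite -subset0 => y /xsectionP/BF/mem_set; rewrite (negbTE Fx).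
Qed.

Lemma product_measure_le_ysection (F : set T2) (B : set (T1 * T2)) (b : \bar R) :
  measurable F -> measurable B -> 0 <= b ->
  (forall x y, B (x, y) -> F y) ->
  (forall y, F y -> m1 (ysection B y) <= b) ->
  (m1 \x m2) B <= m2 F * b.
Proof.
move=> mF mB b0 BF Bb.
rewrite (@product_measure_unique _ _ _ _ _ m1 m2 (m1 \x^ m2)%E)//; last first.
  by move=> A1 A2 mA1 mA2; exact: product_measure2E.
have -> : m2 F * b = \int[m2]_x (b * (\1_F x)%:E).
  rewrite muleC ge0_integralZl ?integral_indic ?setIT//.
  exact: measurableT_comp.
apply: ge0_le_integral => //=.
- exact: measurable_fun_ysection.
- apply: emeasurable_funM => //; exact: measurableT_comp.
move=> y _; rewrite indicE; have [/set_mem/Bb|Fy] := boolP (y \in F).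
  by rewrite mule1.
rewrite mule0 (_ : ysection B y = set0) ?measure0//.
by rewrite -subset0 => x /ysectionP/BF/mem_set; rewrite (negbTE Fy).
Qed.

End product_sections.

Section separated_triples.
Context d (T : measurableType d) (R : realType).
Variables (mu : {sigma_finite_measure set T -> \bar R}) (dist : T -> T -> R).
Hypothesis mdist : measurable_fun setT (fun z : T * T => dist z.1 z.2).
Hypothesis distC : forall x y, dist x y = dist y x.

Let near_set (rho : R) (x : T) : set T := [set y | dist x y < rho].

Let measurable_dist_lt d' (S : measurableType d') (rho : R) (g h : S -> T) :
  measurable_fun setT g -> measurable_fun setT h ->
  measurable [set z | dist (g z) (h z) < rho].
Proof.
move=> mg mh.
have m : measurable_fun setT (fun z => dist (g z) (h z)).
  exact: (measurableT_comp mdist (measurable_fun_pair mg mh)).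
have := m measurableT `]-oo, rho[%classic (measurable_itv _).
by rewrite setTI set_itvNyo.
Qed.

(** Integrate the section bound over the set of smaller measure: the other
    measure is the maximum, whence [u * v] on the right. *)
Lemma near_pair_measure_le (F G : set T) (u v rho : R) :
  measurable F -> measurable G -> mu F = u%:E -> mu G = v%:E ->
  (forall x, mu (near_set rho x) <= (Num.max u v / 4)%:E)%E ->
  ((mu \x mu) [set z | [/\ F z.1, G z.2 & (dist z.1 z.2 < rho)%R]] <=
    (u * v / 4)%:E)%E.
Proof.
move=> mF mG Fu Gv near_le.
have u0 : 0 <= u by rewrite -lee_fin -Fu.
have v0 : 0 <= v by rewrite -lee_fin -Gv.
have uv0 : 0 <= Num.max u v / 4 by rewrite divr_ge0// le_max u0.
have mB : measurable [set z : T * T | [/\ F z.1, G z.2 & dist z.1 z.2 < rho]].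
  rewrite (_ : [set _ | _] = (F `*` G) `&` [set z | dist z.1 z.2 < rho]).
    by apply: measurableI; [exact: measurableX|exact: measurable_dist_lt].
  by apply/seteqP; split=> [z []|z [[]]].
have sle (A : set T) x : measurable A -> A `<=` near_set rho x ->
    (mu A <= (Num.max u v / 4)%:E)%E.
  move=> mA sA; apply: le_trans (near_le x); apply: le_measure => //; rewrite ?inE//.
  exact: measurable_dist_lt.
have [uv|vu] := leP u v.
- have -> : (u * v / 4)%:E = (mu F * (Num.max u v / 4)%:E)%E.
    by rewrite Fu -EFinM (max_r uv) mulrA.
  apply: product_measure_le_xsection => //; first by move=> x y [].
  move=> x Fx; apply: (sle _ x); first exact: measurable_xsection.
  by move=> y /xsectionP[].
- have -> : (u * v / 4)%:E = (mu G * (Num.max u v / 4)%:E)%E.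
    by rewrite Gv -EFinM (max_l (ltW vu)) mulrA [v * u]mulrC.
  apply: product_measure_le_ysection => //; first by move=> x y [].
  move=> y Gy; apply: (sle _ y); first exact: measurable_ysection.
  by move=> x /ysectionP[_ _] /=; rewrite /near_set/= distC.
Qed.

(** For each pair, the triples of [F1 * F2 * F3] that are too close fill at most
    a quarter of the product, so the three bad events together leave out a set
    of positive measure, which the null set [N] cannot exhaust. *)
Lemma separated_triple (F1 F2 F3 : set T) (v1 v2 v3 rho12 rho13 rho23 : R)
    (N : set (T * T * T)) :
  measurable F1 -> measurable F2 -> measurable F3 ->
  mu F1 = v1%:E -> mu F2 = v2%:E -> mu F3 = v3%:E ->
  0 < v1 -> 0 < v2 -> 0 < v3 ->
  (forall x, mu (near_set rho12 x) <= (Num.max v1 v2 / 4)%:E)%E ->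
  (forall x, mu (near_set rho13 x) <= (Num.max v1 v3 / 4)%:E)%E ->
  (forall x, mu (near_set rho23 x) <= (Num.max v2 v3 / 4)%:E)%E ->
  measurable N -> ((mu \x mu) \x mu)%E N = 0%E ->
  exists y1 y2 y3, [/\ F1 y1, F2 y2 & F3 y3] /\
    [/\ rho12 <= dist y1 y2, rho13 <= dist y1 y3, rho23 <= dist y2 y3 &
        ~ N (y1, y2, y3)].
Proof.
move=> m1 m2 m3 F1v F2v F3v v1p v2p v3p n12 n13 n23 mN N0.
have [//|nex] := pselect (exists y1 y2 y3, [/\ F1 y1, F2 y2 & F3 y3] /\
    [/\ rho12 <= dist y1 y2, rho13 <= dist y1 y3, rho23 <= dist y2 y3 &
        ~ N (y1, y2, y3)]); exfalso.
pose B12 := [set z : T * T | [/\ F1 z.1, F2 z.2 & dist z.1 z.2 < rho12]] `*` F3.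
pose B13 := [set z : T * T * T |
  [/\ F1 z.1.1, F2 z.1.2, F3 z.2 & dist z.1.1 z.2 < rho13]].
pose B23 := [set z : T * T * T |
  [/\ F1 z.1.1, F2 z.1.2, F3 z.2 & dist z.1.2 z.2 < rho23]].
have mf : measurable (F1 `*` F2 `*` F3) by do 2 apply: measurableX => //.
have m11 : measurable_fun setT (fun z : T * T * T => z.1.1).
  exact: measurableT_comp.
have m12 : measurable_fun setT (fun z : T * T * T => z.1.2).
  exact: measurableT_comp.
have mB12 : measurable B12.
  apply: measurableX => //.
  rewrite (_ : [set _ | _] = (F1 `*` F2) `&` [set z | dist z.1 z.2 < rho12]).
    by apply: measurableI; [exact: measurableX|exact: measurable_dist_lt].
  by apply/seteqP; split=> [z []|z [[]]].
have mB13 : measurable B13.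
  rewrite (_ : B13 = (F1 `*` F2 `*` F3) `&` [set z | dist z.1.1 z.2 < rho13]).
    by apply: measurableI => //; exact: measurable_dist_lt.
  by apply/seteqP; split=> [z []|z [[[]]]].
have mB23 : measurable B23.
  rewrite (_ : B23 = (F1 `*` F2 `*` F3) `&` [set z | dist z.1.2 z.2 < rho23]).
    by apply: measurableI => //; exact: measurable_dist_lt.
  by apply/seteqP; split=> [z []|z [[[]]]].
have cover : F1 `*` F2 `*` F3 `<=` (N `|` B12) `|` (B13 `|` B23).
  move=> [[y1 y2] y3] /= [[Fy1 Fy2] Fy3].
  have [Ny|Ny] := pselect (N (y1, y2, y3)); first by left; left.
  have [d12|d12] := ltP (dist y1 y2) rho12; first by left; right.
  have [d13|d13] := ltP (dist y1 y3) rho13; first by right; left.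
  have [d23|d23] := ltP (dist y2 y3) rho23; first by right; right.
  by exfalso; apply: nex; exists y1, y2, y3.
pose m := ((mu \x mu) \x mu)%E.
have m2E A B : measurable A -> measurable B ->
    ((mu \x mu) (A `*` B) = mu A * mu B)%E by exact: product_measure1E.
have m3E A B : measurable A -> measurable B ->
    (m (A `*` B) = (mu \x mu) A * mu B)%E by exact: product_measure1E.
have xs := @product_measure_le_xsection _ _ _ _ _ (sigma_finite_prod mu mu) mu.
have ys := @product_measure_le_ysection _ _ _ _ _ (sigma_finite_prod mu mu) mu.
have e12 : (m B12 <= (v1 * v2 * v3 / 4)%:E)%E.
  rewrite m3E//; last first.
    rewrite (_ : [set _ | _] = (F1 `*` F2) `&` [set z | dist z.1 z.2 < rho12]).
      by apply: measurableI; [exact: measurableX|exact: measurable_dist_lt].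
    by apply/seteqP; split=> [z []|z [[]]].
  rewrite F3v (_ : (v1 * v2 * v3 / 4)%:E = (v1 * v2 / 4)%:E * v3%:E)%E; last first.
    by rewrite -EFinM; congr EFin; rewrite -!mulrA [4^-1 * _]mulrC.
  by apply: lee_wpmul2r; [rewrite lee_fin ltW|exact: near_pair_measure_le].
have e13 : (m B13 <= (v1 * v2 * v3 / 4)%:E)%E.
  have [le13|le31] := leP v1 v3.
  - have -> : (v1 * v2 * v3 / 4)%:E = ((mu \x mu) (F1 `*` F2) * (Num.max v1 v3 / 4)%:E)%E.
      by rewrite m2E// F1v F2v -!EFinM (max_r le13) mulrA.
    apply: xs => //; first exact: measurableX.
    - by rewrite lee_fin divr_ge0// le_max ltW.
    - by move=> [a b] c [].
    move=> [a b] /= _; apply: le_trans (n13 a); apply: le_measure => //; rewrite ?inE.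
    - exact: measurable_xsection.
    - exact: measurable_dist_lt.
    - by move=> y /xsectionP[].
  - have -> : (v1 * v2 * v3 / 4)%:E = (mu F3 * (v1 / 4 * v2)%:E)%E.
      rewrite F3v -!EFinM; congr EFin; lra.
    apply: ys => //.
    - by rewrite lee_fin mulr_ge0 ?divr_ge0 ?ltW.
    - by move=> [a b] c [].
    move=> c _.
    have -> : (v1 / 4 * v2)%:E = ((Num.max v1 v3 / 4)%:E * mu F2)%E.
      by rewrite F2v -EFinM (max_l (ltW le31)).
    have mn : measurable (near_set rho13 c) by exact: measurable_dist_lt.
    apply: (@le_trans _ _ ((mu \x mu)%E (near_set rho13 c `*` F2))).
      apply: le_measure => //; rewrite ?inE.
      - exact: measurable_ysection.
      - exact: measurableX.
      - by move=> [a b] /ysectionP[/= _ ? _ ?]; split => //=; rewrite /near_set/= distC.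
    by rewrite m2E//; apply: lee_wpmul2r => //; exact: n13.
have e23 : (m B23 <= (v1 * v2 * v3 / 4)%:E)%E.
  have [le23|le32] := leP v2 v3.
  - have -> : (v1 * v2 * v3 / 4)%:E = ((mu \x mu) (F1 `*` F2) * (Num.max v2 v3 / 4)%:E)%E.
      by rewrite m2E// F1v F2v -!EFinM (max_r le23) mulrA.
    apply: xs => //; first exact: measurableX.
    - by rewrite lee_fin divr_ge0// le_max ltW.
    - by move=> [a b] c [].
    move=> [a b] /= _; apply: le_trans (n23 b); apply: le_measure => //; rewrite ?inE.
    - exact: measurable_xsection.
    - exact: measurable_dist_lt.
    - by move=> y /xsectionP[].
  - have -> : (v1 * v2 * v3 / 4)%:E = (mu F3 * (v1 * (v2 / 4))%:E)%E.
      rewrite F3v -!EFinM; congr EFin; lra.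
    apply: ys => //.
    - by rewrite lee_fin mulr_ge0 ?divr_ge0 ?ltW.
    - by move=> [a b] c [].
    move=> c _.
    have -> : (v1 * (v2 / 4))%:E = (mu F1 * (Num.max v2 v3 / 4)%:E)%E.
      by rewrite F1v -EFinM (max_l (ltW le32)).
    have mn : measurable (near_set rho23 c) by exact: measurable_dist_lt.
    apply: (@le_trans _ _ ((mu \x mu)%E (F1 `*` near_set rho23 c))).
      apply: le_measure => //; rewrite ?inE.
      - exact: measurable_ysection.
      - exact: measurableX.
      - by move=> [a b] /ysectionP[/= ? _ _ ?]; split => //=; rewrite /near_set/= distC.
    by rewrite m2E//; apply: lee_wpmul2l => //; exact: n23.
have : (m (F1 `*` F2 `*` F3) <= (v1 * v2 * v3 / 4)%:E + ((v1 * v2 * v3 / 4)%:E + (v1 * v2 * v3 / 4)%:E))%E.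
  apply: (@le_trans _ _ (m ((N `|` B12) `|` (B13 `|` B23)))).
    by apply: le_measure => //; rewrite ?inE//; do ?apply: measurableU.
  apply: le_trans; first by apply: measureU2; apply: measurableU.
  apply: leeD.
    apply: le_trans; first exact: measureU2.
    by rewrite [X in (X + _)%E]N0 add0e.
  by apply: le_trans; [exact: measureU2|exact: leeD].
rewrite m3E// ?m2E//; last exact: measurableX.
rewrite F1v F2v F3v -!EFinM -!EFinD lee_fin.
have : 0 < v1 * v2 * v3 by rewrite !mulr_gt0.
lra.
Qed.

End separated_triples.

(** * A lower bound for products of maxima *)

Section zonotope.
Variable R : realType.

(** Abel summation: the difference of the two sides is
    [(a12 + a13 - x1) * (l1 - l2) + x3 * (l2 - l3)]. *)
Lemma sum_max_ge_sorted (l1 l2 l3 a12 a13 a23 x1 x2 x3 : R) :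
  l2 <= l1 -> l3 <= l2 -> 0 <= x3 -> x1 <= a12 + a13 ->
  x1 + x2 + x3 = a12 + a13 + a23 ->
  x1 * l1 + x2 * l2 + x3 * l3 <= (a12 + a13) * l1 + a23 * l2.
Proof.
move=> l21 l32 x30 x1a xa.
have h1 : 0 <= (a12 + a13 - x1) * (l1 - l2) by rewrite mulr_ge0 ?subr_ge0.
have h2 : 0 <= x3 * (l2 - l3) by rewrite mulr_ge0 ?subr_ge0.
have -> : x2 = a12 + a13 + a23 - x1 - x3 by lra.
lra.
Qed.

(** The admissible exponents form the Minkowski sum of the segments joining
    [aij] e_i to [aij] e_j, and each factor on the right
    dominates the powers of [vi], [vj] given by any point of its segment.  Taking
    logarithms and ordering the [vj] avoids exhibiting the decomposition. *)
Lemma prod_powR_max_ge (v1 v2 v3 a12 a13 a23 x1 x2 x3 : R) :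
  0 < v1 -> 0 < v2 -> 0 < v3 -> 0 <= x1 -> 0 <= x2 -> 0 <= x3 ->
  x1 <= a12 + a13 -> x2 <= a12 + a23 -> x3 <= a13 + a23 ->
  x1 + x2 + x3 = a12 + a13 + a23 ->
  v1 `^ x1 * v2 `^ x2 * v3 `^ x3 <=
  Num.max v1 v2 `^ a12 * Num.max v1 v3 `^ a13 * Num.max v2 v3 `^ a23.
Proof.
move=> v10 v20 v30 x10 x20 x30 xa1 xa2 xa3 xa.
have powRE (v x : R) : 0 < v -> v `^ x = expR (x * ln v).
  by move=> v0; rewrite /powR gt_eqF.
have ln_le (u v : R) : 0 < u -> 0 < v -> u <= v -> ln u <= ln v.
  by move=> u0 v0; rewrite ler_ln.
have sorted := sum_max_ge_sorted.
have [/(ln_le _ _ v10 v20) h12|/ltW/(ln_le _ _ v20 v10) h12] := leP v1 v2;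
have [/(ln_le _ _ v10 v30) h13|/ltW/(ln_le _ _ v30 v10) h13] := leP v1 v3;
have [/(ln_le _ _ v20 v30) h23|/ltW/(ln_le _ _ v30 v20) h23] := leP v2 v3;
rewrite !powRE// -!expRD ler_expR.
- have := sorted _ _ _ a23 a13 a12 x3 x2 x1 h23 h12 ltac:(lra) ltac:(lra) ltac:(lra); lra.
- have := sorted _ _ _ a23 a12 a13 x2 x3 x1 h23 h13 ltac:(lra) ltac:(lra) ltac:(lra); lra.
- (* the three comparisons are cyclic, so all the logarithms agree *)
  have e2 : ln v2 = ln v1 by lra.
  have e3 : ln v3 = ln v1 by lra.
  rewrite e2 e3 in h12 h13 h23 *.
  have := sorted _ _ _ a12 a13 a23 x1 x2 x3 h12 h12 ltac:(lra) ltac:(lra) ltac:(lra); lra.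
- have := sorted _ _ _ a12 a23 a13 x2 x1 x3 h12 h13 ltac:(lra) ltac:(lra) ltac:(lra); lra.
- have := sorted _ _ _ a13 a23 a12 x3 x1 x2 h13 h12 ltac:(lra) ltac:(lra) ltac:(lra); lra.
- (* the three comparisons are cyclic, so all the logarithms agree *)
  have e2 : ln v2 = ln v1 by lra.
  have e3 : ln v3 = ln v1 by lra.
  rewrite e2 e3 in h12 h13 h23 *.
  have := sorted _ _ _ a12 a13 a23 x1 x2 x3 h12 h12 ltac:(lra) ltac:(lra) ltac:(lra); lra.
- have := sorted _ _ _ a13 a12 a23 x1 x3 x2 h13 h23 ltac:(lra) ltac:(lra) ltac:(lra); lra.
- have := sorted _ _ _ a12 a13 a23 x1 x2 x3 h12 h23 ltac:(lra) ltac:(lra) ltac:(lra); lra.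
Qed.

End zonotope.


(** * The weak-type inequality *)

Section suprema.
Variable R : realType.

Lemma sup_le_of_mul_le (S : set R) (B c : R) :
  0 < c -> S !=set0 -> (forall a, S a -> a * c <= B) ->
  has_sup S /\ sup S * c <= B.
Proof.
move=> c0 S0 SB; have ubS : ubound S (B / c).
  by move=> a /SB; rewrite ler_pdivlMr.
split; first by split => //; exists (B / c).
by rewrite -ler_pdivlMr//; exact: ge_sup.
Qed.

Lemma sup_gt0 (S : set R) :
  has_sup S -> (forall a, S a -> 0 < a) -> 0 < sup S.
Proof.
move=> [[a Sa] ubS] S_gt0; apply: lt_le_trans (S_gt0 a Sa) _.
exact: sup_ubound.
Qed.

(** Freezing two of the factors at positive values bounds the third set; this is
    how one inequality on products makes all three weak norms finite. *)
Lemma sup3_le (S1 S2 S3 : set R) (B : R) :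
  S1 !=set0 -> S2 !=set0 -> S3 !=set0 ->
  (forall a, S1 a -> 0 < a) -> (forall a, S2 a -> 0 < a) ->
  (forall a, S3 a -> 0 < a) ->
  (forall a b c, S1 a -> S2 b -> S3 c -> a * b * c <= B) ->
  [/\ has_sup S1, has_sup S2, has_sup S3 & sup S1 * sup S2 * sup S3 <= B].
Proof.
move=> S10 S20 S30 p1 p2 p3 SB.
have [[b0 Sb0] [c0 Sc0]] := (S20, S30).
have h1 b c : S2 b -> S3 c -> has_sup S1 /\ sup S1 * (b * c) <= B.
  move=> Sb Sc; apply: (sup_le_of_mul_le (mulr_gt0 (p2 _ Sb) (p3 _ Sc))) => //.
  by move=> a Sa; rewrite mulrA; exact: SB.
have [hs1 _] := h1 _ _ Sb0 Sc0.
have s1 : 0 < sup S1 by exact: sup_gt0.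
have h2 c : S3 c -> has_sup S2 /\ sup S2 * (sup S1 * c) <= B.
  move=> Sc; apply: (sup_le_of_mul_le (mulr_gt0 s1 (p3 _ Sc))) => //.
  by move=> b Sb; rewrite mulrCA; exact: (h1 _ _ Sb Sc).2.
have [hs2 _] := h2 _ Sc0.
have s2 : 0 < sup S2 by exact: sup_gt0.
have [hs3 le3] : has_sup S3 /\ sup S3 * (sup S1 * sup S2) <= B.
  apply: (sup_le_of_mul_le (mulr_gt0 s1 s2)) => //.
  by move=> c Sc; have := (h2 _ Sc).2; rewrite mulrA [leLHS]mulrC [sup S2 * _]mulrC.
by split; rewrite // [leLHS]mulrC.
Qed.

End suprema.

Section weak_level_sets.
Context d (T : measurableType d) (R : realType).
Variable mu : {sigma_finite_measure set T -> \bar R}.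

(** Allows to work with real measures only, even for superlevel sets that are
    not known in advance to have finite measure. *)
Lemma measure_le_finite_subsets (E : set T) (b : R) :
  measurable E ->
  (forall F v, measurable F -> F `<=` E -> mu F = v%:E -> v <= b) ->
  (mu E <= b%:E)%E.
Proof.
move=> mE Eb; have /sigma_finiteP[F [TF ndF Foo]] := sigma_finiteT mu.
have mEF k : measurable (E `&` F k) by apply: measurableI => //; exact: (Foo k).1.
have EE : \bigcup_k (E `&` F k) = E by rewrite -setI_bigcupr -TF setIT.
have ndEF : nondecreasing_seq (fun k => E `&` F k).
  by move=> i j ij; apply/subsetPset; apply: setIS; exact/subsetPset/ndF.
have mU : measurable (\bigcup_k (E `&` F k)) by rewrite EE.
have h := nondecreasing_cvg_mu (mu := mu) mEF mU ndEF.
rewrite -[X in mu X]EE -(cvg_lim _ h)//; apply: lime_le.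
  by apply/cvg_ex; eexists; exact: h.
apply: nearW => k /=.
have fin : mu (E `&` F k) \is a fin_num.
  rewrite ge0_fin_numE//; apply: le_lt_trans (Foo k).2.
  by apply: le_measure; rewrite ?inE//; exact: (Foo k).1.
rewrite -(fineK fin) lee_fin; apply: (Eb (E `&` F k)) => //; rewrite ?fineK//.
Qed.

Variables (dist : T -> T -> R) (n : nat) (K : R).
Hypothesis mdist : measurable_fun setT (fun z : T * T => dist z.1 z.2).
Hypothesis distC : forall x y, dist x y = dist y x.
Hypothesis n_gt0 : (0 < n)%N.
Hypothesis K_gt0 : 0 < K.
Hypothesis ball_le : forall (rho : R) x, 0 <= rho ->
  (mu [set y | (dist x y < rho)%R] <= (K * rho ^+ n)%:E)%E.

(** The radii are chosen so that a ball of radius [rho u v] has measure at most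
    a quarter of [max u v], as [separated_triple] requires; evaluating the
    hypothesis at a separated triple then gives the claim, and the constant
    collects the factors [4 * K] of the three radii. *)
Lemma weak_triple (f1 f2 f3 : T -> R) (F1 F2 F3 : set T) (N : set (T * T * T))
    (t1 t2 t3 v1 v2 v3 r12 r13 r23 x1 x2 x3 A : R) :
  0 <= t1 -> 0 <= t2 -> 0 <= t3 ->
  measurable F1 -> measurable F2 -> measurable F3 ->
  F1 `<=` [set y | t1 <= f1 y] -> F2 `<=` [set y | t2 <= f2 y] ->
  F3 `<=` [set y | t3 <= f3 y] ->
  mu F1 = v1%:E -> mu F2 = v2%:E -> mu F3 = v3%:E ->
  0 < v1 -> 0 < v2 -> 0 < v3 ->
  0 <= r12 -> 0 <= r13 -> 0 <= r23 ->
  0 <= x1 -> 0 <= x2 -> 0 <= x3 ->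
  x1 <= (r12 + r13) / n%:R -> x2 <= (r12 + r23) / n%:R ->
  x3 <= (r13 + r23) / n%:R -> x1 + x2 + x3 = (r12 + r13 + r23) / n%:R ->
  measurable N -> ((mu \x mu) \x mu)%E N = 0%E ->
  (forall y1 y2 y3, ~ N (y1, y2, y3) ->
    f1 y1 * f2 y2 * f3 y3 *
    (dist y1 y2 `^ r12 * dist y1 y3 `^ r13 * dist y2 y3 `^ r23) <= A) ->
  t1 * v1 `^ x1 * (t2 * v2 `^ x2) * (t3 * v3 `^ x3) <=
  (4 * K) `^ ((r12 + r13 + r23) / n%:R) * A.
Proof.
move=> t10 t20 t30 mF1 mF2 mF3 F1t F2t F3t F1v F2v F3v v10 v20 v30 r120 r130 r230.
move=> x10 x20 x30 xa1 xa2 xa3 xa mN N0 fA.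
have nR0 : 0 < n%:R :> R by rewrite ltr0n.
pose rho u v := (Num.max u v / (4 * K)) `^ n%:R^-1.
have K40 : 0 < 4 * K by rewrite mulr_gt0.
have near_le u v : 0 < u -> forall x,
    (mu [set y | (dist x y < rho u v)%R] <= (Num.max u v / 4)%:E)%E.
  move=> u0 x; apply: (le_trans (ball_le _ (powR_ge0 _ _))).
  rewrite lee_fin -powR_mulrn ?powR_ge0// -powRrM mulVf ?gt_eqF// powRr1.
    rewrite (_ : K * (Num.max u v / (4 * K)) = Num.max u v / 4)//.
    by field; rewrite gt_eqF.
  by rewrite divr_ge0 ?(ltW K40)// le_max ltW.
have [y1 [y2 [y3 [[F1y F2y F3y] [d12 d13 d23 Ny]]]]] :=
  separated_triple mdist distC mF1 mF2 mF3 F1v F2v F3v v10 v20 v30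
    (near_le v1 v2 v10) (near_le v1 v3 v10) (near_le v2 v3 v20) mN N0.
have := fA _ _ _ Ny.
have rho_powR u v r : 0 < u -> 0 <= r ->
    rho u v `^ r = Num.max u v `^ (r / n%:R) / (4 * K) `^ (r / n%:R).
  move=> u0 r0; rewrite -powRrM [n%:R^-1 * r]mulrC (@powRM _ (Num.max u v)) ?invr_ge0 ?(ltW K40)//.
    by rewrite -[(4 * K)^-1]powR_inv1 ?(ltW K40)// -powRrM mulN1r powRN.
  by rewrite le_max ltW.
have dle u v a b r : 0 <= r -> rho u v <= dist a b -> rho u v `^ r <= dist a b `^ r.
  move=> r0 h; apply: ge0_ler_powR => //; rewrite nnegrE ?powR_ge0//.
  by apply: le_trans h; exact: powR_ge0.
move=> fA'; rewrite -ler_pdivrMl ?powR_gt0//; apply: le_trans fA'.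
apply: (@le_trans _ _ (t1 * t2 * t3 *
    (rho v1 v2 `^ r12 * rho v1 v3 `^ r13 * rho v2 v3 `^ r23))).
  rewrite !rho_powR//.
  have h := prod_powR_max_ge v10 v20 v30 x10 x20 x30.
  have {}h := h (r12 / n%:R) (r13 / n%:R) (r23 / n%:R).
  rewrite -!mulrDl in h.
  have {}h := h xa1 xa2 xa3 xa.
  have -> : (4 * K) `^ ((r12 + r13 + r23) / n%:R) =
      (4 * K) `^ (r12 / n%:R) * (4 * K) `^ (r13 / n%:R) * (4 * K) `^ (r23 / n%:R).
    by move: (4 * K) K40 => k k0; rewrite !mulrDl !powRD// (gt_eqF k0) implybT.
  have p12 : 0 < (4 * K) `^ (r12 / n%:R) by exact: powR_gt0.
  have p13 : 0 < (4 * K) `^ (r13 / n%:R) by exact: powR_gt0.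
  have p23 : 0 < (4 * K) `^ (r23 / n%:R) by exact: powR_gt0.
  set k12 := (4 * K) `^ _ in p12 *; set k13 := (4 * K) `^ _ in p13 *.
  set k23 := (4 * K) `^ _ in p23 *.
  set m12 := Num.max v1 v2 `^ _ in h *; set m13 := Num.max v1 v3 `^ _ in h *.
  set m23 := Num.max v2 v3 `^ _ in h *.
  have -> : t1 * t2 * t3 * (m12 / k12 * (m13 / k13) * (m23 / k23)) =
      (k12 * k13 * k23)^-1 * (t1 * t2 * t3 * (m12 * m13 * m23)).
    by field; rewrite !gt_eqF.
  apply: ler_wpM2l; first by rewrite invr_ge0 !mulr_ge0// ltW.
  have -> : t1 * v1 `^ x1 * (t2 * v2 `^ x2) * (t3 * v3 `^ x3) =
    t1 * t2 * t3 * (v1 `^ x1 * v2 `^ x2 * v3 `^ x3) by ring.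
  by apply: ler_wpM2l => //; rewrite !mulr_ge0.
apply: ler_pM; rewrite ?mulr_ge0 ?powR_ge0//.
  apply: ler_pM; rewrite ?mulr_ge0//; last exact: F3t.
  by apply: ler_pM => //; [exact: F1t|exact: F2t].
apply: ler_pM; rewrite ?mulr_ge0 ?powR_ge0//; last exact: dle.
by apply: ler_pM; rewrite ?powR_ge0//; exact: dle.
Qed.

End weak_level_sets.

(** * From two weak bounds to an integral bound *)

Section strong_from_weak.
Context d (T : measurableType d) (R : realType).
Variable mu : {measure set T -> \bar R}.

(** Powers of [2] reach the large values and powers of [2^-1] the small ones, so
    that two series indexed by natural numbers replace one indexed by the
    integers. *)
Lemma dyadic_bracket (z : R) : 0 < z -> exists k : nat,
  2 ^+ k <= z <= 2 * 2 ^+ k \/ 2^-1 ^+ k <= z <= 2 * 2^-1 ^+ k.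
Proof.
move=> z0; have [z1|z1] := leP 1 z.
- have ex : exists k : nat, z < 2 ^+ k.+1.
    exists (Num.bound z); apply: (lt_le_trans (archi_boundP (ltW z0))).
    by rewrite -natrX ler_nat; apply: ltnW; apply: ltnW; exact: ltn_expl.
  case: (ex_minnP ex) => k zk mink; exists k; left.
  rewrite -exprS (ltW zk) andbT; case: k zk mink => [|k] zk mink.
    by rewrite expr0.
  by rewrite leNgt; apply/negP => /mink; rewrite ltnn.
- have ex : exists k : nat, 2^-1 ^+ k <= z.
    exists (Num.bound z^-1); rewrite exprVn -[leRHS]invrK lef_pV2 ?posrE ?exprn_gt0 ?invr_gt0//.
    apply: ltW; apply: (lt_le_trans (archi_boundP _)); rewrite ?invr_ge0 ?(ltW z0)//.
    by rewrite -natrX ler_nat; apply: ltnW; exact: ltn_expl.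
  case: (ex_minnP ex) => k zk mink; exists k; right.
  rewrite zk /=; case: k zk mink => [|k] zk mink.
    by rewrite expr0 mulr1; apply: (le_trans (ltW z1)); rewrite ler1n.
  rewrite exprS mulrA divff// mul1r leNgt; apply/negP => /ltW /mink.
  by rewrite ltnn.
Qed.

Variable f : T -> R.
Hypothesis mf : measurable_fun setT f.
Hypothesis f_ge0 : forall x, 0 <= f x.
Variables (p l V : R).
Hypotheses (p_gt0 : 0 < p) (l_gt0 : 0 < l) (V_ge0 : 0 <= V).

Let level (s : R) : set T := [set x | s <= f x].

Lemma measurable_superlevel (s : R) : measurable [set x | s <= f x].
Proof.
have := mf measurableT (measurable_itv `[s, +oo[).
by rewrite setTI set_itvE.
Qed.

(** With [b = 2] this dominates [f `^ p] where [f] is at least [l], with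
    [b = 2^-1] where it is at most [2 * l]. *)
Let layers (b : R) (x : T) : \bar R :=
  (\sum_(k <oo) ((2 * l * b ^+ k) `^ p)%:E * (\1_(level (l * b ^+ k)) x)%:E)%E.

Let layer_ge0 b k x :
  (0 <= ((2 * l * b ^+ k) `^ p)%:E * (\1_(level (l * b ^+ k)) x)%:E)%E.
Proof. by rewrite mule_ge0// lee_fin ?powR_ge0// indicE. Qed.

Let measurable_layer b k : measurable_fun setT
  (fun x => ((2 * l * b ^+ k) `^ p)%:E * (\1_(level (l * b ^+ k)) x)%:E)%E.
Proof.
apply: emeasurable_funM => //; apply/measurable_EFinP.
by apply: measurable_indic; exact: measurable_superlevel.
Qed.

Let measurable_layers b : measurable_fun setT (layers b).
Proof. by apply: ge0_emeasurable_sum. Qed.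

Let layers_ge0 b x : (0 <= layers b x)%E.
Proof. exact: nneseries_ge0. Qed.

Let layers_ge b k x : l * b ^+ k <= f x <= 2 * l * b ^+ k ->
  ((f x `^ p)%:E <= layers b x)%E.
Proof.
move=> /andP[lf fl].
have f0 : 0 <= 2 * l * b ^+ k by exact: le_trans fl.
apply: (@le_trans _ _ (((2 * l * b ^+ k) `^ p)%:E * (\1_(level (l * b ^+ k)) x)%:E)%E).
  rewrite indicE mem_set// mule1 lee_fin.
  by apply: ge0_ler_powR; rewrite ?nnegrE ?(ltW p_gt0).
rewrite /layers (@nneseriesD1 _ _ k)//.
by rewrite leeDl//; apply: nneseries_ge0 => i _ _; exact: layer_ge0.
Qed.

Let integral_layers b q : 0 < b -> b `^ (p - q) < 1 ->
  (forall s : R, (0 < s)%R -> mu [set x | (s <= f x)%R] <= (V * (l / s) `^ q)%:E)%E ->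
  (\int[mu]_x layers b x <= ((2 * l) `^ p * V / (1 - b `^ (p - q)))%:E)%E.
Proof.
move=> b0 b1 fV.
rewrite integral_nneseries//.
have term k : (\int[mu]_x (((2 * l * b ^+ k) `^ p)%:E * (\1_(level (l * b ^+ k)) x)%:E)
    <= (geometric ((2 * l) `^ p * V) (b `^ (p - q)) k)%:E)%E.
  rewrite ge0_integralZl//; last 2 first.
  - apply/measurable_EFinP; apply: measurable_indic; exact: measurable_superlevel.
  - by rewrite lee_fin powR_ge0.
  rewrite integral_indic ?setIT//; last exact: measurable_superlevel.
  have lb0 : 0 < l * b ^+ k by rewrite mulr_gt0// exprn_gt0.
  apply: (le_trans (lee_wpmul2l _ (fV _ lb0))); first by rewrite lee_fin powR_ge0.
  rewrite -EFinM lee_fin /geometric/=.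
  have bk0 : 0 < b ^+ k by rewrite exprn_gt0.
  have -> : l / (l * b ^+ k) = (b ^+ k)^-1.
    by rewrite invfM mulrA divff ?gt_eqF// mul1r.
  rewrite powRM ?mulr_ge0 ?(ltW l_gt0) ?(ltW bk0)//.
  have -> : (b ^+ k)^-1 `^ q = ((b ^+ k) `^ q)^-1.
    by rewrite -[X in X `^ q]powR_inv1 ?(ltW bk0)// -powRrM mulN1r powRN.
  have -> : b `^ (p - q) ^+ k = (b ^+ k) `^ p / (b ^+ k) `^ q.
    rewrite -powRB; last by rewrite (gt_eqF bk0) implybT.
    by rewrite -(powR_mulrn k (powR_ge0 _ _)) -(powR_mulrn k (ltW b0)) powRAC.
  by rewrite le_eqVlt; apply/orP; left; apply/eqP; ring.
apply: (le_trans (lee_nneseries _ (fun k _ => term k))).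
  by move=> k _ _; apply: integral_ge0 => x _; exact: layer_ge0.
apply: lime_le.
  by apply: is_cvg_nneseries => k _ _; rewrite lee_fin mulr_ge0 ?mulr_ge0 ?exprn_ge0 ?powR_ge0.
apply: nearW => k; rewrite sumEFin lee_fin.
apply: geometric_le_lim; rewrite ?mulr_ge0 ?powR_ge0 ?powR_gt0//.
by rewrite ger0_norm ?powR_ge0.
Qed.

(** The bound with exponent [q2 > p] makes the dyadic layers above height [l]
    summable, the one with [q1 < p] those below.  Both bounds are normalised to
    the common value [V] at height [l], the height at which they cross. *)
Lemma integral_powR_le_weak (q1 q2 : R) : q1 < p -> p < q2 ->
  (forall s : R, (0 < s)%R -> mu [set x | (s <= f x)%R] <= (V * (l / s) `^ q1)%:E)%E ->
  (forall s : R, (0 < s)%R -> mu [set x | (s <= f x)%R] <= (V * (l / s) `^ q2)%:E)%E ->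
  (\int[mu]_x (f x `^ p)%:E <=
    (2 `^ p * ((1 - 2 `^ (p - q2))^-1 + (1 - 2^-1 `^ (p - q1))^-1) *
     (l `^ p * V))%:E)%E.
Proof.
move=> q1p pq2 w1 w2.
have b2 : 2 `^ (p - q2) < 1 :> R.
  rewrite /powR (_ : (2 == 0 :> R) = false)//; last by apply/negbTE.
  by rewrite -[ltRHS]expR0 ltr_expR pmulr_llt0 ?ln_gt0 ?ltr1n// subr_lt0.
have b1 : 2^-1 `^ (p - q1) < 1 :> R.
  rewrite /powR (_ : (2^-1 == 0 :> R) = false); last by apply/negbTE; rewrite invr_eq0.
  rewrite -[ltRHS]expR0 ltr_expR lnV ?posrE// mulrN oppr_lt0.
  by rewrite mulr_gt0 ?ln_gt0 ?ltr1n// subr_gt0.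
apply: (@le_trans _ _ (\int[mu]_x (layers 2 x + layers 2^-1 x))%E).
  apply: ge0_le_integral => //.
  - by move=> x _; rewrite lee_fin powR_ge0.
  - by apply/measurable_EFinP; exact: (measurableT_comp (measurable_powR p)).
  - exact: emeasurable_funD.
  move=> x _; have [fx0|fx0] := leP (f x) 0.
    have -> : f x = 0 by apply/eqP; rewrite eq_le fx0 f_ge0.
    by rewrite powR0 ?gt_eqF// adde_ge0.
  have [k [/andP[h1 h2]|/andP[h1 h2]]] := dyadic_bracket (divr_gt0 fx0 l_gt0).
  - rewrite ler_pdivlMr// mulrC in h1; rewrite ler_pdivrMr// in h2.
    apply: (@le_trans _ _ (layers 2 x)); last by rewrite leeDl.
    by apply: (@layers_ge _ k); rewrite h1 /= [2 * l * _]mulrAC.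
  - rewrite ler_pdivlMr// mulrC in h1; rewrite ler_pdivrMr// in h2.
    apply: (@le_trans _ _ (layers 2^-1 x)); last by rewrite leeDr.
    by apply: (@layers_ge _ k); rewrite h1 /= [2 * l * _]mulrAC.
rewrite ge0_integralD//.
apply: (le_trans (leeD (integral_layers _ b2 w2) (integral_layers _ b1 w1))) => //.
rewrite -EFinD lee_fin powRM ?(ltW l_gt0)//.
by rewrite le_eqVlt; apply/orP; left; apply/eqP; ring.
Qed.

End strong_from_weak.

(** * Sufficiency *)

Section weak_norm.
Context d (T : measurableType d) (R : realType).
Variable mu : {sigma_finite_measure set T -> \bar R}.
Implicit Types (f : T -> R) (x p s : R).

(** The supremum of this set is the weak norm sup_t t |{f >= t}|^x.  Subsets of
    finite positive measure replace the superlevel sets, so that the values are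
    positive reals. *)
Definition weak_values f x : set R := [set w | exists t F v,
  [/\ 0 < t, measurable F, F `<=` [set y | t <= f y], mu F = v%:E & 0 < v] /\
  w = t * v `^ x].

Lemma weak_values_gt0 f x w : weak_values f x w -> 0 < w.
Proof. by move=> [t [F [v [[t0 _ _ _ v0] ->]]]]; rewrite mulr_gt0 ?powR_gt0. Qed.

(** Either [f] charges some superlevel set, and then has weak values for every
    exponent, or it vanishes almost everywhere. *)
Lemma weak_values_nonempty f : measurable_fun setT f ->
  (forall x, weak_values f x !=set0) \/
  (forall s, 0 < s -> (mu [set y | (s <= f y)%R] <= 0)%E).
Proof.
move=> mf; have [|nW] := pselect (forall x, weak_values f x !=set0); first by left.
right => s s0; apply: measure_le_finite_subsets.
  exact: measurable_superlevel.
move=> F v mF Fs Fv; rewrite leNgt; apply/negP => v0; apply: nW => x.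
by exists (s * v `^ x), s, F, v.
Qed.

Lemma superlevel_le_weak f x (l V : R) : measurable_fun setT f ->
  0 < x -> 0 < l -> 0 < V -> has_sup (weak_values f x) ->
  sup (weak_values f x) = l * V `^ x ->
  forall s, 0 < s ->
  (mu [set y | (s <= f y)%R] <= (V * (l / s) `^ x^-1)%:E)%E.
Proof.
move=> mf x0 l0 V0 hW supW s s0; apply: measure_le_finite_subsets.
  exact: measurable_superlevel.
move=> F v mF Fs Fv; have [v0|v0] := leP v 0.
  by apply: (le_trans v0); rewrite mulr_ge0 ?powR_ge0 ?ltW.
have : s * v `^ x <= l * V `^ x.
  by rewrite -supW; apply: sup_ubound; [exact: hW.2|exists s, F, v].
rewrite -ler_pdivlMl// => h.
have : (v `^ x) `^ x^-1 <= (s^-1 * (l * V `^ x)) `^ x^-1.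
  by apply: ge0_ler_powR => //; rewrite ?nnegrE ?invr_ge0 ?powR_ge0 ?ltW//
    !mulr_gt0 ?invr_gt0 ?powR_gt0.
rewrite -powRrM divff ?gt_eqF// powRr1 ?(ltW v0)// mulrA (@powRM _ (s^-1 * l)) ?powR_ge0//.
  by rewrite -powRrM divff ?gt_eqF// powRr1 ?(ltW V0)// mulrC [s^-1 * l]mulrC.
by rewrite mulr_ge0 ?invr_ge0 ?ltW.
Qed.

Lemma Lnorm_powE f p : 0 < p -> (forall y, 0 <= f y) ->
  ('N[mu]_p%:E [EFin \o f] = (\int[mu]_x (f x `^ p)%:E) `^ p^-1)%E.
Proof.
move=> p0 f0; rewrite Lnorm.unlock.
rewrite (_ : (fun y => (f y `^ p)%:E) = (fun y => `|(EFin \o f) y| `^ p)%E)//.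
by apply/funext => y /=; rewrite ger0_norm// poweR_EFin.
Qed.

Lemma Lnorm_eq0_null f p : measurable_fun setT f -> (forall y, 0 <= f y) ->
  0 < p -> (forall s, 0 < s -> (mu [set y | (s <= f y)%R] <= 0)%E) ->
  ('N[mu]_p%:E [EFin \o f] = 0)%E.
Proof.
move=> mf f0 p0 null; rewrite Lnorm_powE//.
suff -> : (\int[mu]_x (f x `^ p)%:E = 0)%E by rewrite poweR0r// invr_eq0 gt_eqF.
apply/eqP; rewrite eq_le integral_ge0 ?andbT//; last first.
  by move=> x _; rewrite lee_fin powR_ge0.
have z q s : 0 < s -> (mu [set y | (s <= f y)%R] <= (0 * (1 / s) `^ q)%:E)%E.
  by rewrite mul0r; exact: null.
apply: (le_trans (integral_powR_le_weak mf f0 p0 ltr01 (lexx 0) _ _ (z (p - 1)) (z (p + 1)))).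
- by rewrite ltrBlDr ltrDl.
- by rewrite ltrDl.
by rewrite !mulr0.
Qed.

(** The two superlevel bounds derived from the weak norms [P] and [M] cross at a
    height [l] where both equal [V], and the L^p norm is at most of order
    [l * V `^ p^-1].  Since the exponents average to [1/p] with weights 1/3 and
    2/3, this is [P `^ (1/3) * M `^ (2/3)]; the cube avoids fractional powers. *)
Lemma Lnorm_le_weak p (e : R) : 0 < p -> 0 < e -> e < p^-1 ->
  exists2 C : R, 0 < C & forall f, measurable_fun setT f -> (forall y, 0 <= f y) ->
  has_sup (weak_values f (p^-1 + 2 * e)) -> has_sup (weak_values f (p^-1 - e)) ->
  exists2 N : R, 0 <= N /\
    N ^+ 3 = sup (weak_values f (p^-1 + 2 * e)) * sup (weak_values f (p^-1 - e)) ^+ 2 &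
  ('N[mu]_p%:E [EFin \o f] <= (C * N)%:E)%E.
Proof.
move=> p0 e0 ep; have ip0 : 0 < p^-1 by rewrite invr_gt0.
set xp := p^-1 + 2 * e; set xm := p^-1 - e.
have xp0 : 0 < xp by rewrite /xp; lra.
have xm0 : 0 < xm by rewrite /xm; lra.
have qp : xp^-1 < p by rewrite -[ltRHS]invrK ltf_pV2 ?posrE// /xp; lra.
have qm : p < xm^-1 by rewrite -[ltLHS]invrK ltf_pV2 ?posrE// /xm; lra.
pose C0 : R := 2 `^ p * ((1 - 2 `^ (p - xm^-1))^-1 + (1 - 2^-1 `^ (p - xp^-1))^-1).
exists (Num.max C0 1 `^ p^-1); first by rewrite powR_gt0// lt_max ltr01 orbT.
move=> f mf f0 hp hm.
set P := sup _; set M := sup _.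
have P0 : 0 < P by apply: sup_gt0 hp _ => w; exact: weak_values_gt0.
have M0 : 0 < M by apply: sup_gt0 hm _ => w; exact: weak_values_gt0.
(* the solution of [P = l * V `^ xp] and [M = l * V `^ xm] *)
pose V := (P / M) `^ (3 * e)^-1; pose l := M / V `^ xm.
have V0 : 0 < V by rewrite powR_gt0// divr_gt0.
have l0 : 0 < l by rewrite divr_gt0// powR_gt0.
have MV : M = l * V `^ xm by rewrite /l divfK// gt_eqF// powR_gt0.
have PV : P = l * V `^ xp.
  rewrite (_ : xp = xm + 3 * e); last by rewrite /xp /xm; lra.
  rewrite powRD ?(gt_eqF V0) ?implybT// mulrA -MV /V -powRrM mulVf ?gt_eqF ?mulr_gt0//.
  by rewrite powRr1 ?divr_ge0 ?ltW// mulrC divfK// gt_eqF.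
exists (l * V `^ p^-1).
  split; first by rewrite mulr_ge0 ?powR_ge0 ?ltW.
  have Vne x : V `^ x != 0 by rewrite gt_eqF// powR_gt0.
  have VD x y : V `^ (x + y) = V `^ x * V `^ y.
    by rewrite powRD// (gt_eqF V0) implybT.
  rewrite PV MV /xp /xm mulr_natl mulr2n !VD powRN.
  by field.
rewrite Lnorm_powE//.
have h := integral_powR_le_weak mf f0 p0 l0 (ltW V0) qp qm
  (superlevel_le_weak mf xp0 l0 V0 hp PV) (superlevel_le_weak mf xm0 l0 V0 hm MV).
apply: (@le_trans _ _ (((Num.max C0 1 * (l `^ p * V))%:E) `^ p^-1)%E).
  apply: gt0_ler_poweR; rewrite ?invr_ge0 ?(ltW p0)// ?in_itv /= ?andbT ?leey ?integral_ge0//.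
  - by move=> x _; rewrite lee_fin powR_ge0.
  - by rewrite lee_fin !mulr_ge0 ?powR_ge0 ?(ltW V0)// le_max ler01 orbT.
  apply: (le_trans h); rewrite lee_fin; apply: ler_wpM2r.
    by rewrite mulr_ge0 ?powR_ge0 ?(ltW V0).
  by rewrite le_max lexx.
rewrite poweR_EFin lee_fin powRM ?le_max ?ler01 ?orbT//; last first.
  by rewrite mulr_ge0 ?powR_ge0 ?(ltW V0).
by rewrite powRM ?powR_ge0 ?(ltW V0)// -powRrM divff ?gt_eqF// powRr1 ?(ltW l0).
Qed.

End weak_norm.

Section sufficiency.
Context d (T : measurableType d) (R : realType).
Variable mu : {sigma_finite_measure set T -> \bar R}.
Variables (dist : T -> T -> R) (n : nat) (K : R).
Hypothesis mdist : measurable_fun setT (fun z : T * T => dist z.1 z.2).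
Hypothesis distC : forall x y, dist x y = dist y x.
Hypothesis n_gt0 : (0 < n)%N.
Hypothesis K_gt0 : 0 < K.
Hypothesis ball_le : forall (rho : R) x, 0 <= rho ->
  (mu [set y | (dist x y < rho)%R] <= (K * rho ^+ n)%:E)%E.

(** Each of the three weak inequalities involves one exponent [1/pj + 2 * e] and
    two exponents [1/pi - e]; in their product every function contributes the
    cube of the geometric mean of [Lnorm_le_weak]. *)
Lemma prod_Lnorm_le (r12 r13 r23 p1 p2 p3 : R) :
  0 < r12 -> 0 < r13 -> 0 < r23 -> 0 < p1 -> 0 < p2 -> 0 < p3 ->
  p1^-1 < (r12 + r13) / n%:R -> p2^-1 < (r12 + r23) / n%:R ->
  p3^-1 < (r13 + r23) / n%:R ->
  p1^-1 + p2^-1 + p3^-1 = (r12 + r13 + r23) / n%:R ->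
  exists2 C : R, 0 < C & forall (f1 f2 f3 : T -> R) (N : set (T * T * T)) (A : R),
    measurable_fun setT f1 -> measurable_fun setT f2 -> measurable_fun setT f3 ->
    (forall x, 0 <= f1 x) -> (forall x, 0 <= f2 x) -> (forall x, 0 <= f3 x) ->
    measurable N -> ((mu \x mu) \x mu)%E N = 0%E -> 0 <= A ->
    (forall y1 y2 y3, ~ N (y1, y2, y3) ->
      f1 y1 * f2 y2 * f3 y3 *
      (dist y1 y2 `^ r12 * dist y1 y3 `^ r13 * dist y2 y3 `^ r23) <= A) ->
    ('N[mu]_p1%:E [EFin \o f1] * 'N[mu]_p2%:E [EFin \o f2] *
     'N[mu]_p3%:E [EFin \o f3] <= (C * A)%:E)%E.
Proof.
move=> r120 r130 r230 p10 p20 p30 a1 a2 a3 sump.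
have [i1 i2 i3] : [/\ 0 < p1^-1, 0 < p2^-1 & 0 < p3^-1] by rewrite !invr_gt0.
(* half the distance to the boundary leaves room for a shift by [2 * e] *)
pose m := Num.min (Num.min (Num.min p1^-1 p2^-1) p3^-1)
  (Num.min (Num.min ((r12 + r13) / n%:R - p1^-1) ((r12 + r23) / n%:R - p2^-1))
     ((r13 + r23) / n%:R - p3^-1)).
pose e := m / 2.
have e0 : 0 < e by rewrite divr_gt0// !lt_min i1 i2 i3 !subr_gt0 a1 a2 a3.
have : e * 2 <= m by rewrite /e divfK.
rewrite /m !le_min.
move=> /andP[/andP[/andP[e1 e2] e3] /andP[/andP[e4 e5] e6]].
clearbody e.
have [lo1 lo2 lo3] : [/\ 0 <= p1^-1 - e, 0 <= p2^-1 - e & 0 <= p3^-1 - e].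
  by split; lra.
have [hi1 hi2 hi3] : [/\ 0 <= p1^-1 + 2 * e, 0 <= p2^-1 + 2 * e & 0 <= p3^-1 + 2 * e].
  by split; lra.
have [la1 la2 la3] : [/\ p1^-1 - e <= (r12 + r13) / n%:R,
    p2^-1 - e <= (r12 + r23) / n%:R & p3^-1 - e <= (r13 + r23) / n%:R].
  by split; lra.
have [ha1 ha2 ha3] : [/\ p1^-1 + 2 * e <= (r12 + r13) / n%:R,
    p2^-1 + 2 * e <= (r12 + r23) / n%:R & p3^-1 + 2 * e <= (r13 + r23) / n%:R].
  by split; lra.
have sum1 : p1^-1 + 2 * e + (p2^-1 - e) + (p3^-1 - e) = (r12 + r13 + r23) / n%:R.
  by lra.
have sum2 : p1^-1 - e + (p2^-1 + 2 * e) + (p3^-1 - e) = (r12 + r13 + r23) / n%:R.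
  by lra.
have sum3 : p1^-1 - e + (p2^-1 - e) + (p3^-1 + 2 * e) = (r12 + r13 + r23) / n%:R.
  by lra.
have [C1 C10 H1] := @Lnorm_le_weak _ _ _ mu _ _ p10 e0 ltac:(lra).
have [C2 C20 H2] := @Lnorm_le_weak _ _ _ mu _ _ p20 e0 ltac:(lra).
have [C3 C30 H3] := @Lnorm_le_weak _ _ _ mu _ _ p30 e0 ltac:(lra).
pose B0 := (4 * K) `^ ((r12 + r13 + r23) / n%:R).
have B00 : 0 < B0 by rewrite powR_gt0// mulr_gt0.
exists (C1 * C2 * C3 * B0); first by rewrite !mulr_gt0.
move=> f1 f2 f3 N A mf1 mf2 mf3 f10 f20 f30 mN N0 A0 fA.
have CA0 : (0 <= (C1 * C2 * C3 * B0 * A)%:E)%E.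
  by rewrite lee_fin !mulr_ge0// ltW.
have [W1|null1] := weak_values_nonempty mu mf1; last first.
  by rewrite (Lnorm_eq0_null mf1)// !mul0e.
have [W2|null2] := weak_values_nonempty mu mf2; last first.
  by rewrite (Lnorm_eq0_null mf2)// mule0 mul0e.
have [W3|null3] := weak_values_nonempty mu mf3; last first.
  by rewrite (Lnorm_eq0_null mf3)// mule0.
have pattern x1 x2 x3 : 0 <= x1 -> 0 <= x2 -> 0 <= x3 ->
    x1 <= (r12 + r13) / n%:R -> x2 <= (r12 + r23) / n%:R ->
    x3 <= (r13 + r23) / n%:R -> x1 + x2 + x3 = (r12 + r13 + r23) / n%:R ->
    [/\ has_sup (weak_values mu f1 x1), has_sup (weak_values mu f2 x2),
        has_sup (weak_values mu f3 x3) &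
        sup (weak_values mu f1 x1) * sup (weak_values mu f2 x2) *
        sup (weak_values mu f3 x3) <= B0 * A].
  move=> x10 x20 x30 xa1 xa2 xa3 xa.
  apply: sup3_le => //; do 1?[exact: weak_values_gt0].
  move=> _ _ _ [t1 [F1 [v1 [[t10 mF1 F1t F1v v10] ->]]]]
    [t2 [F2 [v2 [[t20 mF2 F2t F2v v20] ->]]]]
    [t3 [F3 [v3 [[t30 mF3 F3t F3v v30] ->]]]].
  apply: (weak_triple mdist distC n_gt0 K_gt0 ball_le (ltW t10) (ltW t20) (ltW t30)
    mF1 mF2 mF3 F1t F2t F3t F1v F2v F3v v10 v20 v30 (ltW r120) (ltW r130) (ltW r230)
    x10 x20 x30 xa1 xa2 xa3 xa mN N0 fA).
have [p1P m2 m3 le1] := pattern _ _ _ hi1 lo2 lo3 ha1 la2 la3 sum1.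
have [m1 p2P _ le2] := pattern _ _ _ lo1 hi2 lo3 la1 ha2 la3 sum2.
have [_ _ p3P le3] := pattern _ _ _ lo1 lo2 hi3 la1 la2 ha3 sum3.
have [N1 [N10 N1E] {}H1] := H1 f1 mf1 f10 p1P m1.
have [N2 [N20 N2E] {}H2] := H2 f2 mf2 f20 p2P m2.
have [N3 [N30 N3E] {}H3] := H3 f3 mf3 f30 p3P m3.
apply: (@le_trans _ _ ((C1 * N1)%:E * (C2 * N2)%:E * (C3 * N3)%:E)%E).
  by do 2 (apply: lee_pmul; rewrite ?mule_ge0 ?Lnorm_ge0//).
rewrite -!EFinM lee_fin.
have -> : C1 * N1 * (C2 * N2) * (C3 * N3) = C1 * C2 * C3 * (N1 * N2 * N3) by ring.
have -> : C1 * C2 * C3 * B0 * A = C1 * C2 * C3 * (B0 * A) by ring.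
apply: ler_wpM2l; first by rewrite !mulr_ge0// ltW.
have N0' : 0 <= N1 * N2 * N3 by rewrite !mulr_ge0.
have BA0 : 0 <= B0 * A by rewrite mulr_ge0// ltW.
rewrite -(@ler_pXn2r _ 3)// ?nnegrE//.
rewrite [in leLHS]exprMn [(N1 * N2) ^+ 3]exprMn N1E N2E N3E.
have sup0 f x : has_sup (weak_values mu f x) -> 0 <= sup (weak_values mu f x).
  by move=> h; apply/ltW/(sup_gt0 h) => w; exact: weak_values_gt0.
move: le1 le2 le3 (sup0 _ _ p1P) (sup0 _ _ p2P) (sup0 _ _ p3P).
move: (sup0 _ _ m1) (sup0 _ _ m2) (sup0 _ _ m3).
move: (sup (weak_values mu f1 (p1^-1 + 2 * e))) => P1.
move: (sup (weak_values mu f2 (p2^-1 + 2 * e))) => P2.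
move: (sup (weak_values mu f3 (p3^-1 + 2 * e))) => P3.
move: (sup _) (sup _) (sup _) => M3 M2 M1.
move=> M10 M20 M30 le1 le2 le3 P10 P20 P30.
have -> : P1 * M1 ^+ 2 * (P2 * M2 ^+ 2) * (P3 * M3 ^+ 2) =
  (P1 * M2 * M3) * (M1 * P2 * M3) * (M1 * M2 * P3) by ring.
rewrite exprSr expr2.
by apply: ler_pM; rewrite ?mulr_ge0//; apply: ler_pM; rewrite ?mulr_ge0.
Qed.

End sufficiency.

(** * Necessity *)

Section necessity.
Variables (R : realType) (n : nat).
Hypothesis n_gt0 : (0 < n)%N.
Local Notation E := (euclidean R n).
Local Notation mu := (lebesgue_euclidean R n).
Local Notation dist := (@euclidean_dist R n).
Local Notation Q := (cube (fun=> 0) : R -> set E).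

(** The inequality of the theorem with an everywhere bound instead of the
    essential supremum, which is what test functions provide, and with the three
    functions as separate arguments, so that indices can be permuted. *)
Definition sup_controls (p1 p2 p3 r12 r13 r23 D : R) : Prop :=
  forall (f1 f2 f3 : E -> R) (A : R),
    measurable_fun setT f1 -> measurable_fun setT f2 -> measurable_fun setT f3 ->
    (forall y, 0 <= f1 y) -> (forall y, 0 <= f2 y) -> (forall y, 0 <= f3 y) ->
    0 <= A ->
    (forall y1 y2 y3, f1 y1 * f2 y2 * f3 y3 *
      (dist y1 y2 `^ r12 * dist y1 y3 `^ r13 * dist y2 y3 `^ r23) <= A) ->
    ('N[mu]_p1%:E [EFin \o f1] * 'N[mu]_p2%:E [EFin \o f2] *
     'N[mu]_p3%:E [EFin \o f3] <= (D * A)%:E)%E.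

Lemma sup_controls_swap12 (p1 p2 p3 r12 r13 r23 D : R) :
  sup_controls p1 p2 p3 r12 r13 r23 D -> sup_controls p2 p1 p3 r12 r23 r13 D.
Proof.
move=> H f1 f2 f3 A m1 m2 m3 f10 f20 f30 A0 fA.
rewrite [X in (X * _)%E]muleC; apply: H => // y1 y2 y3.
have := fA y2 y1 y3; rewrite (euclidean_distC y2 y1).
move: (_ `^ r12) (_ `^ r13) (_ `^ r23) (f1 y2) (f2 y1) => a b c u v.
by rewrite [u * v]mulrC [a * c * b]mulrAC.
Qed.

Lemma sup_controls_swap13 (p1 p2 p3 r12 r13 r23 D : R) :
  sup_controls p1 p2 p3 r12 r13 r23 D -> sup_controls p3 p2 p1 r23 r13 r12 D.
Proof.
move=> H f1 f2 f3 A m1 m2 m3 f10 f20 f30 A0 fA.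
have revE (a b c : \bar R) : (a * b * c = c * b * a)%E.
  by rewrite muleC [(a * b)%E]muleC muleA.
rewrite revE; apply: H => // y1 y2 y3.
have := fA y3 y2 y1; rewrite (euclidean_distC y3 y2) (euclidean_distC y3 y1).
rewrite (euclidean_distC y2 y1).
have rev (a b c : R) : a * b * c = c * b * a by rewrite mulrC [a * b]mulrC mulrA.
move: (_ `^ r12) (_ `^ r13) (_ `^ r23) (f1 y3) (f2 y2) (f3 y1) => a b c u v w.
by rewrite [u * v * w]rev [a * b * c]rev.
Qed.

Lemma dist_cube_le (l : R) (x y : E) : 0 <= l -> Q l x -> Q l y ->
  dist x y <= Num.sqrt n%:R * l.
Proof.
move=> l0 xl yl; apply: euclidean_dist_le => // k.
rewrite ler_norml; have /andP[] := xl k; have /andP[] := yl k; lra.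
Qed.

Lemma Lnorm_indic_cube (l p : R) : 0 <= l -> 0 < p ->
  ('N[mu]_p%:E [EFin \o \1_(Q l)] = ((l `^ n%:R) `^ p^-1)%:E)%E.
Proof.
move=> l0 p0; rewrite Lnorm_powE//.
rewrite (_ : (fun y => _) = (fun y => (\1_(Q l) y)%:E)); last first.
  apply/funext => y; rewrite indicE; case: (_ \in _) => /=; rewrite ?powR1//.
  by rewrite powR0// gt_eqF.
rewrite integral_indic//; last exact: measurable_cube.
rewrite setIT [X in (X `^ _)%E](_ : _ = (l ^+ n)%:E); last exact: lebesgue_cube.
by rewrite poweR_EFin powR_mulrn.
Qed.

(** Testing on cubes of side [l] bounds a power of [l] uniformly in [l > 0],
    hence its exponent vanishes. *)
Lemma sup_controls_sum (p1 p2 p3 r12 r13 r23 D : R) :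
  0 < p1 -> 0 < p2 -> 0 < p3 -> 0 < r12 -> 0 < r13 -> 0 < r23 ->
  sup_controls p1 p2 p3 r12 r13 r23 D ->
  p1^-1 + p2^-1 + p3^-1 = n%:R^-1 * (r12 + r13 + r23).
Proof.
move=> p10 p20 p30 r120 r130 r230 H.
have nR0 : 0 < n%:R :> R by rewrite ltr0n.
pose s := r12 + r13 + r23; pose u := p1^-1 + p2^-1 + p3^-1.
pose B := D * Num.sqrt n%:R `^ s.
have key l : 0 < l -> l `^ (n%:R * u - s) <= B.
  move=> l0; have L0 : 0 <= Num.sqrt n%:R * l by rewrite mulr_ge0 ?sqrtr_ge0 ?ltW.
  have := H \1_(Q l) \1_(Q l) \1_(Q l) ((Num.sqrt n%:R * l) `^ s).
  have m : measurable_fun setT (\1_(Q l) : E -> R).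
    by apply: measurable_indic; exact: measurable_cube.
  have ge0 (y : E) : 0 <= \1_(Q l) y :> R by rewrite indicE.
  move=> /(_ m m m ge0 ge0 ge0 (powR_ge0 _ _)).
  have bound (y1 y2 y3 : E) : \1_(Q l) y1 * \1_(Q l) y2 * \1_(Q l) y3 *
      (dist y1 y2 `^ r12 * dist y1 y3 `^ r13 * dist y2 y3 `^ r23) <=
      (Num.sqrt n%:R * l) `^ s.
    rewrite !indicE.
    have [/set_mem h1|_] := boolP (y1 \in Q l); last by rewrite !mul0r powR_ge0.
    have [/set_mem h2|_] := boolP (y2 \in Q l); last by rewrite mulr0 !mul0r powR_ge0.
    have [/set_mem h3|_] := boolP (y3 \in Q l); last by rewrite mulr0 !mul0r powR_ge0.
    have L00 : Num.sqrt n%:R * l != 0 by rewrite mulf_neq0 ?gt_eqF ?sqrtr_gt0.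
    rewrite !mulr1 mul1r /s !powRD ?L00 ?implybT//.
    have dl (a b : E) r : 0 < r -> Q l a -> Q l b ->
        dist a b `^ r <= (Num.sqrt n%:R * l) `^ r.
      move=> r0 la lb; apply: ge0_ler_powR; rewrite ?nnegrE ?(ltW r0) ?euclidean_dist_ge0//.
      by apply: dist_cube_le => //; exact: ltW.
    apply: ler_pM; rewrite ?mulr_ge0 ?powR_ge0//; last exact: dl.
    by apply: ler_pM; rewrite ?powR_ge0//; exact: dl.
  move=> /(_ bound); rewrite !Lnorm_indic_cube ?(ltW l0)// -!EFinM lee_fin.
  have lne x : l `^ x != 0 by rewrite gt_eqF// powR_gt0.
  have lD x y : l `^ (x + y) = l `^ x * l `^ y.
    by rewrite powRD// (gt_eqF l0) implybT.
  rewrite -!powRrM -!lD -!mulrDr powRM ?sqrtr_ge0 ?(ltW l0)// mulrA.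
  by rewrite -ler_pdivrMr ?powR_gt0// -powRN -lD.
have [e0|e0] := eqVneq (n%:R * u) s; first by rewrite -/s -e0 mulKf// gt_eqF.
have e1 : n%:R * u - s != 0 by rewrite subr_eq0.
have B0 : 0 <= B by apply: le_trans (key 1 ltr01); exact: powR_ge0.
have B10 : 0 < B + 1 by rewrite ltr_wpDl.
(* the side for which the power of [l] equals [B + 1] *)
have := key ((B + 1) `^ (n%:R * u - s)^-1) (powR_gt0 _ B10).
by rewrite -powRrM mulVf// powRr1 ?(ltW B10)//; lra.
Qed.

(** The sum is dominated by its first nonzero term [M / 2 ^+ k <= 1] and the
    geometric series that follows; the induction keeps track of what is left. *)
Lemma dyadic_tail_sum_le2 (M : R) (N : nat) : 0 <= M ->
  \sum_(k < N) (if M <= 2 ^+ k then M / 2 ^+ k else 0) <= 2.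
Proof.
move=> M0.
suff : \sum_(k < N) (if M <= 2 ^+ k then M / 2 ^+ k else 0) <=
    if M <= 2 ^+ N then 2 - 2 * (M / 2 ^+ N) else 0.
  move=> /le_trans; apply; case: ifPn => // _.
  by rewrite gerBl mulr_ge0// divr_ge0// exprn_ge0.
elim: N => [|N IHN].
  by rewrite big_ord0 expr0 divr1; case: ifPn => // M1; lra.
rewrite big_ord_recr /=; apply: (le_trans (lerD IHN (lexx _))).
have p0 : 0 < 2 ^+ N :> R by rewrite exprn_gt0.
have -> : M / 2 ^+ N.+1 = M / 2 ^+ N / 2 by rewrite exprSr invfM mulrA.
have [MN|MN] := leP M (2 ^+ N).
  rewrite (le_trans MN) ?exprS ?ler_peMl ?ler1n ?(ltW p0)//; lra.
rewrite addr0; case: ifPn => //; rewrite exprSr -ler_pdivrMl// mulrC => MN1; lra.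
Qed.

(** A function of the order of |y|^(-n) on the positive orthant, between radii 1
    and [2 ^+ N]; each of its [N] layers has integral one. *)
Definition dyadic_profile (N : nat) (y : E) : R :=
  \sum_(k < N) (2 ^+ k) ^- n * \1_(Q (2 ^+ k)) y.

(** A sup norm truncated below at one, meant for points with nonnegative
    coordinates only. *)
Definition max_coord (y : E) : R := \big[Num.max/1]_(k < n) tnth y k.

Lemma dyadic_profile_ge0 (N : nat) (y : E) : 0 <= dyadic_profile N y.
Proof.
rewrite /dyadic_profile; apply: sumr_ge0 => k _; apply: mulr_ge0.
  by rewrite invr_ge0 !exprn_ge0.
by rewrite indicE ler0n.
Qed.

Lemma measurable_dyadic_profile (N : nat) : measurable_fun setT (dyadic_profile N).
Proof.
rewrite /dyadic_profile; apply: measurable_sum => k.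
apply: measurable_funM; first exact: measurable_cst.
by apply: measurable_indic; exact: measurable_cube.
Qed.

Lemma max_coord_ge1 (y : E) : 1 <= max_coord y.
Proof. exact: bigmax_ge_id. Qed.

Lemma tnth_le_max_coord (y : E) (k : 'I_n) : tnth y k <= max_coord y.
Proof. exact: le_bigmax. Qed.

Lemma dyadic_profile_decay (N : nat) (y : E) :
  dyadic_profile N y * max_coord y ^+ n <= 2.
Proof.
have M1 := max_coord_ge1 y; have M0 : 0 <= max_coord y by exact: le_trans M1.
apply: le_trans (dyadic_tail_sum_le2 N M0).
rewrite /dyadic_profile mulr_suml; apply: ler_sum => k _.
have k0 : 0 < 2 ^+ k :> R by rewrite exprn_gt0.
rewrite indicE; have [/set_mem yk|_] := boolP (y \in Q (2 ^+ k)); last first.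
  by rewrite mulr0 mul0r; case: ifPn => // _; rewrite divr_ge0 ?(ltW k0).
have Mk : max_coord y <= 2 ^+ k.
  apply: bigmax_le => [|i _]; first by rewrite exprn_ege1// ler1n.
  by have /andP[_] := yk i; rewrite add0r.
rewrite Mk mulr1 mulrC -exprVn -exprMn -[leRHS]expr1.
apply: ler_wiXn2l => //; first by rewrite divr_ge0 ?(ltW k0).
by rewrite ler_pdivrMr// mul1r.
Qed.

Lemma dyadic_profile_outside (N : nat) (y : E) :
  ~ (forall k, 0 <= tnth y k) -> dyadic_profile N y = 0.
Proof.
move=> ny; apply: big1 => k _; rewrite indicE memNset ?mulr0// => yk.
by apply: ny => i; have /andP[] := yk i.
Qed.

Lemma integral_dyadic_profile (N : nat) :
  (\int[mu]_y (dyadic_profile N y)%:E = N%:R%:E)%E.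
Proof.
rewrite (_ : (fun y => _) = (fun y =>
    \sum_(k < N) ((2 ^+ k) ^- n)%:E * (\1_(Q (2 ^+ k)) y)%:E)%E); last first.
  by apply/funext => y; rewrite /dyadic_profile -sumEFin.
have m k : measurable_fun setT (fun y : E => (\1_(Q (2 ^+ k)) y)%:E : \bar R).
  by apply/measurable_EFinP; apply: measurable_indic; exact: measurable_cube.
pose layer (k : 'I_N) (y : E) := (((2 ^+ k) ^- n)%:E * (\1_(Q (2 ^+ k)) y)%:E : \bar R)%E.
have mlayer k : measurable_fun setT (layer k) by exact: emeasurable_funM.
have layer0 k y : setT y -> (0 <= layer k y)%E.
  move=> _; apply: mule_ge0; first by rewrite lee_fin invr_ge0 !exprn_ge0.
  by rewrite lee_fin indicE ler0n.
rewrite (ge0_integral_sum mu measurableT mlayer layer0).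
rewrite (eq_bigr (fun=> 1%:E)) => [|k _].
  by rewrite sumEFin sumr_const card_ord.
rewrite ge0_integralZl// ?lee_fin ?invr_ge0 ?exprn_ge0//.
rewrite integral_indic//; last exact: measurable_cube.
rewrite setIT [X in (_ * X)%E](_ : _ = ((2 ^+ k) ^+ n)%:E); last first.
  by apply: lebesgue_cube; rewrite exprn_ge0.
by rewrite -EFinM mulVf// !expf_neq0.
Qed.

(** The test function for the first argument is the [1/p1]-th power of the
    dyadic profile.  If [1/p1] were at least [(r12 + r13) / n], the decay of the
    profile would absorb the distances to [y2] and [y3], which are at most a
    multiple of [max_coord y1], and [N `^ (1/p1)] would remain bounded. *)
Lemma sup_controls_lt (p1 p2 p3 r12 r13 r23 D : R) :
  0 < p1 -> 0 < p2 -> 0 < p3 -> 0 < r12 -> 0 < r13 -> 0 < r23 ->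
  sup_controls p1 p2 p3 r12 r13 r23 D -> p1^-1 < n%:R^-1 * (r12 + r13).
Proof.
move=> p10 p20 p30 r120 r130 r230 H; rewrite ltNge; apply/negP => rp.
have nR0 : 0 < n%:R :> R by rewrite ltr0n.
have rp' : r12 + r13 <= n%:R * p1^-1 by rewrite -ler_pdivrMl.
have sn0 : 0 < Num.sqrt n%:R :> R by rewrite sqrtr_gt0.
pose A := 2 `^ p1^-1 * Num.sqrt n%:R `^ (r12 + r13 + r23) : R.
have key N : N%:R `^ p1^-1 <= D * A.
  have m1 : measurable_fun setT (fun y => dyadic_profile N y `^ p1^-1).
    exact: (measurableT_comp (measurable_powR _) (measurable_dyadic_profile N)).
  have mQ : measurable_fun setT (\1_(Q 1) : E -> R).
    by apply: measurable_indic; exact: measurable_cube.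
  have Q0 (y : E) : 0 <= \1_(Q 1) y :> R by rewrite indicE.
  have A0 : 0 <= A by rewrite mulr_ge0 ?powR_ge0.
  have := H _ _ _ A m1 mQ mQ (fun y => powR_ge0 _ _) Q0 Q0 A0.
  have bound (y1 y2 y3 : E) : dyadic_profile N y1 `^ p1^-1 * \1_(Q 1) y2 * \1_(Q 1) y3 *
      (dist y1 y2 `^ r12 * dist y1 y3 `^ r13 * dist y2 y3 `^ r23) <= A.
    rewrite !indicE.
    have [/set_mem h2|_] := boolP (y2 \in Q 1); last by rewrite mulr0 !mul0r.
    have [/set_mem h3|_] := boolP (y3 \in Q 1); last by rewrite mulr0 !mul0r.
    have [y1pos|y1neg] := pselect (forall k, 0 <= tnth y1 k); last first.
      by rewrite dyadic_profile_outside// powR0 ?invr_eq0 ?gt_eqF// !mul0r.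
    have M1 := max_coord_ge1 y1; have M0 : 0 < max_coord y1 by exact: lt_le_trans M1.
    have dM (z : E) : Q 1 z -> dist y1 z <= Num.sqrt n%:R * max_coord y1.
      move=> zQ; apply: euclidean_dist_le; first exact: ltW.
      move=> k; rewrite ler_norml; have /andP[] := zQ k.
      have := y1pos k; have := tnth_le_max_coord y1 k; lra.
    rewrite !mulr1.
    apply: (@le_trans _ _ (dyadic_profile N y1 `^ p1^-1 *
        ((Num.sqrt n%:R * max_coord y1) `^ r12 *
         (Num.sqrt n%:R * max_coord y1) `^ r13 * Num.sqrt n%:R `^ r23))).
      apply: ler_wpM2l; first exact: powR_ge0.
      have d0 := @euclidean_dist_ge0 R n.
      apply: ler_pM; rewrite ?mulr_ge0 ?powR_ge0//; last first.
        apply: ge0_ler_powR; rewrite ?nnegrE ?(ltW r230) ?sqrtr_ge0//.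
        by rewrite -[leRHS]mulr1; exact: dist_cube_le.
      apply: ler_pM; rewrite ?powR_ge0//; apply: ge0_ler_powR;
        rewrite ?nnegrE ?(ltW r120) ?(ltW r130) ?mulr_ge0 ?(ltW sn0) ?(ltW M0)//; exact: dM.
    rewrite -powRD; last by rewrite mulf_neq0 ?implybT ?gt_eqF.
    rewrite powRM ?(ltW sn0) ?(ltW M0)//.
    rewrite [leLHS](_ : _ = dyadic_profile N y1 `^ p1^-1 * max_coord y1 `^ (r12 + r13) *
       (Num.sqrt n%:R `^ (r12 + r13) * Num.sqrt n%:R `^ r23)); last first.
      rewrite -[RHS]mulrA; congr (_ * _).
      by rewrite [LHS]mulrAC [LHS]mulrC.
    rewrite -powRD; last by rewrite (gt_eqF sn0) implybT.
    apply: ler_wpM2r; first exact: powR_ge0.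
    apply: (@le_trans _ _ (dyadic_profile N y1 `^ p1^-1 * (max_coord y1 ^+ n) `^ p1^-1)).
      apply: ler_wpM2l; first exact: powR_ge0.
      by rewrite -powR_mulrn ?(ltW M0)// -powRrM; exact: ler_powR.
    rewrite -powRM ?dyadic_profile_ge0 ?exprn_ge0 ?(ltW M0)//.
    apply: ge0_ler_powR; rewrite ?nnegrE ?invr_ge0 ?(ltW p10)//.
    - by rewrite mulr_ge0 ?dyadic_profile_ge0 ?exprn_ge0 ?(ltW M0).
    - exact: dyadic_profile_decay.
  move=> /(_ bound); rewrite !Lnorm_indic_cube// !powR1 !mule1.
  rewrite Lnorm_powE//; last by move=> y; exact: powR_ge0.
  rewrite [X in (X `^ _)%E](_ : _ = N%:R%:E).
    by rewrite poweR_EFin lee_fin.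
  rewrite -integral_dyadic_profile; apply: eq_integral => y _.
  by rewrite -powRrM mulVf ?gt_eqF// powRr1// dyadic_profile_ge0.
have DA0 : 0 <= D * A by apply: le_trans (key 0%N); exact: powR_ge0.
pose N := Num.bound ((D * A) `^ p1).
have /archi_boundP hN := powR_ge0 (D * A) p1.
have := key N; apply/negP; rewrite -ltNge.
have -> : D * A = ((D * A) `^ p1) `^ p1^-1.
  by rewrite -powRrM divff ?gt_eqF// powRr1.
by apply: (gt0_ltr_powR _ _ _ hN); rewrite ?invr_gt0 ?nnegrE ?powR_ge0 ?ler0n.
Qed.

End necessity.

(** * The essential supremum over triples of points *)

Definition o0 : 'I_3 := @Ordinal 3 0 isT.
Definition o1 : 'I_3 := @Ordinal 3 1 isT.
Definition o2 : 'I_3 := @Ordinal 3 2 isT.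

Lemma ord3P (P : 'I_3 -> Prop) : P o0 -> P o1 -> P o2 -> forall j, P j.
Proof.
move=> P0 P1 P2 [[|[|[|//]]] j3].
- by rewrite (_ : Ordinal j3 = o0) //; apply: val_inj.
- by rewrite (_ : Ordinal j3 = o1) //; apply: val_inj.
- by rewrite (_ : Ordinal j3 = o2) //; apply: val_inj.
Qed.

Section big_ord3.
Variables (V : Type) (idx : V) (op : Monoid.law idx).

Lemma big_ord3 (F : 'I_3 -> V) :
  \big[op/idx]_(j < 3) F j = op (op (F o0) (F o1)) (F o2).
Proof.
rewrite !big_ord_recr big_ord0 /= Monoid.mul1m.
by congr (op (op (F _) (F _)) (F _)); apply: val_inj.
Qed.

Lemma big_ord3_cond (P : pred 'I_3) (F : 'I_3 -> V) :
  \big[op/idx]_(j < 3 | P j) F j =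
  op (op (if P o0 then F o0 else idx) (if P o1 then F o1 else idx))
     (if P o2 then F o2 else idx).
Proof. by rewrite big_mkcond big_ord3. Qed.

Lemma big_ord3_pairs (F : 'I_3 -> 'I_3 -> V) :
  \big[op/idx]_(i < 3) \big[op/idx]_(j < 3 | (i < j)%N) F i j =
  op (op (F o0 o1) (F o0 o2)) (F o1 o2).
Proof. by rewrite big_ord3 !big_ord3_cond /= !Monoid.mul1m !Monoid.mulm1. Qed.

End big_ord3.

Section ess_sup3.
Variables (R : realType) (n : nat).
Local Notation E := (euclidean R n).
Local Notation mu3 := (lebesgue_euclidean3 R n).

Lemma lebesgue_euclidean3_setT_gt0 : (0 < mu3 setT)%E.
Proof.
pose c : set E := cube (fun=> 0) 1.
have mc : measurable c by exact: measurable_cube.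
have c1 : lebesgue_euclidean R n c = 1%E.
  by rewrite [LHS]lebesgue_cube// expr1n.
apply: (@lt_le_trans _ _ (mu3 (c `*` c `*` c))); last first.
  by apply: le_measure => //; rewrite inE//; do 2 apply: measurableX => //.
have -> : mu3 (c `*` c `*` c) =
    ((lebesgue_euclidean R n \x lebesgue_euclidean R n) (c `*` c) *
     lebesgue_euclidean R n c)%E.
  by apply: product_measure1E => //; exact: measurableX.
rewrite c1 mule1 [X in (_ < X)%E](_ : _ =
  (lebesgue_euclidean R n c * lebesgue_euclidean R n c)%E).
  by rewrite c1 mule1.
by apply: product_measure1E.
Qed.

(** The absolute value is there because the constant of the theorem may have any
    sign, whereas enlarging the supremum to [A] needs a nonnegative factor. *)
Lemma sup_controls_of_ess_sup (p1 p2 p3 r12 r13 r23 C : R) :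
  (forall f1 f2 f3 : E -> R,
    measurable_fun setT f1 -> measurable_fun setT f2 -> measurable_fun setT f3 ->
    (forall y, 0 <= f1 y) -> (forall y, 0 <= f2 y) -> (forall y, 0 <= f3 y) ->
    ('N[lebesgue_euclidean R n]_p1%:E [EFin \o f1] *
     'N[lebesgue_euclidean R n]_p2%:E [EFin \o f2] *
     'N[lebesgue_euclidean R n]_p3%:E [EFin \o f3] <=
     C%:E * ess_sup mu3 (fun y => (f1 y.1.1 * f2 y.1.2 * f3 y.2 *
       (euclidean_dist y.1.1 y.1.2 `^ r12 * euclidean_dist y.1.1 y.2 `^ r13 *
        euclidean_dist y.1.2 y.2 `^ r23))%:E))%E) ->
  sup_controls n p1 p2 p3 r12 r13 r23 `|C|.
Proof.
move=> H f1 f2 f3 A m1 m2 m3 f10 f20 f30 A0 fA.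
apply: (le_trans (H f1 f2 f3 m1 m2 m3 f10 f20 f30)).
set g := (fun y => _); set S := ess_sup _ _.
have S0 : (0 <= S)%E.
  apply: ess_sup_gee; first exact: lebesgue_euclidean3_setT_gt0.
  by apply: nearW => y; rewrite lee_fin !mulr_ge0 ?powR_ge0.
have SA : (S <= A%:E)%E by apply/ess_supP; apply: nearW => y; rewrite lee_fin.
apply: (@le_trans _ _ (`|C|%:E * S)%E).
  by apply: lee_wpmul2r => //; rewrite lee_fin ler_norm.
by rewrite EFinM; apply: lee_wpmul2l; rewrite ?lee_fin.
Qed.

End ess_sup3.

Unset Implicit Arguments.

Theorem theorem3p5 (R : realType) (n : nat) (n_ge1 : (1 <= n)%N)
    (r : 'I_3 -> 'I_3 -> R)
    (r_gt0 : forall i j, i != j -> 0 < r i j)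
    (r_sym : forall i j, i != j -> r i j = r j i)
    (p : 'I_3 -> R) (p_gt0 : forall j, 0 < p j) :
  (exists C : R, forall f : 'I_3 -> euclidean R n -> R,
      (forall j, measurable_fun [set: euclidean R n] (f j)) ->
      (forall j x, 0 <= f j x) ->
      (\prod_(j < 3) 'N[lebesgue_euclidean R n]_(p j)%:E [EFin \o f j] <=
       C%:E * ess_sup (lebesgue_euclidean3 R n) (fun y =>
         ((\prod_(j < 3) f j (proj3 y j)) *
          (\prod_(i < 3) \prod_(j < 3 | (i < j)%N)
             euclidean_dist (proj3 y i) (proj3 y j) `^ r i j))%:E))%E)
  <->
  (\sum_(j < 3) (p j)^-1 =
     n%:R^-1 * \sum_(i < 3) \sum_(j < 3 | (i < j)%N) r i j /\
   forall j, (p j)^-1 < n%:R^-1 * \sum_(i < 3 | i != j) r i j).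

Proof.
have r10 : r o1 o0 = r o0 o1 by exact: r_sym.
have r20 : r o2 o0 = r o0 o2 by exact: r_sym.
have r21 : r o2 o1 = r o1 o2 by exact: r_sym.
have [r01p r02p r12p] : [/\ 0 < r o0 o1, 0 < r o0 o2 & 0 < r o1 o2].
  by split; exact: r_gt0.
have sumrE : \sum_(i < 3) \sum_(j < 3 | (i < j)%N) r i j =
    r o0 o1 + r o0 o2 + r o1 o2 by rewrite big_ord3_pairs.
have [star0 star1 star2] :
    [/\ \sum_(i < 3 | i != o0) r i o0 = r o0 o1 + r o0 o2,
        \sum_(i < 3 | i != o1) r i o1 = r o0 o1 + r o1 o2 &
        \sum_(i < 3 | i != o2) r i o2 = r o0 o2 + r o1 o2].
  by split; rewrite big_ord3_cond /= ?add0r ?addr0 ?r10 ?r20 ?r21.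
have supE (f : 'I_3 -> euclidean R n -> R) :
    (fun y : euclidean R n * euclidean R n * euclidean R n =>
      ((\prod_(j < 3) f j (proj3 y j)) *
        (\prod_(i < 3) \prod_(j < 3 | (i < j)%N)
           euclidean_dist (proj3 y i) (proj3 y j) `^ r i j))%:E) =
    (fun y => (f o0 y.1.1 * f o1 y.1.2 * f o2 y.2 *
       (euclidean_dist y.1.1 y.1.2 `^ r o0 o1 *
        euclidean_dist y.1.1 y.2 `^ r o0 o2 *
        euclidean_dist y.1.2 y.2 `^ r o1 o2))%:E).
  by apply/funext => y; rewrite big_ord3_pairs big_ord3.
have normE (f : 'I_3 -> euclidean R n -> R) :
    (\prod_(j < 3) 'N[lebesgue_euclidean R n]_(p j)%:E [EFin \o f j] =
     'N[lebesgue_euclidean R n]_(p o0)%:E [EFin \o f o0] *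
     'N[lebesgue_euclidean R n]_(p o1)%:E [EFin \o f o1] *
     'N[lebesgue_euclidean R n]_(p o2)%:E [EFin \o f o2])%E.
  by rewrite big_ord3.
split=> [[C HC]|[sump ltp]].
- have H : sup_controls n (p o0) (p o1) (p o2) (r o0 o1) (r o0 o2) (r o1 o2) `|C|.
    apply: sup_controls_of_ess_sup => f0 f1 f2 m0 m1 m2 f0p f1p f2p.
    pose f (j : 'I_3) := if j == o0 then f0 else if j == o1 then f1 else f2.
    have mf j : measurable_fun [set: euclidean R n] (f j) by move: j; apply: ord3P.
    have fp j x : 0 <= f j x by move: j; apply: ord3P.
    by have := HC f mf fp; rewrite normE supE.
  split.
    by rewrite sumrE big_ord3; exact: (sup_controls_sum _ _ _ _ _ _ _ H).
  apply: ord3P.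
  + by rewrite star0; exact: (sup_controls_lt _ _ _ _ _ _ _ H).
  + rewrite star1.
    by apply: (sup_controls_lt _ _ _ _ _ _ _ (sup_controls_swap12 H)).
  + rewrite star2 addrC.
    by apply: (sup_controls_lt _ _ _ _ _ _ _ (sup_controls_swap13 H)).
- pose K : R := 2 ^+ n.
  have K0 : 0 < K by rewrite exprn_gt0.
  have ball_le (rho : R) (x : euclidean R n) : 0 <= rho ->
      (lebesgue_euclidean R n [set y | (euclidean_dist x y < rho)%R] <=
       (K * rho ^+ n)%:E)%E.
    move=> rho0; rewrite -exprMn; apply: (@lebesgue_ball_le _ _ x) => //; last first.
      by move=> y /= /ltW.
    have m : measurable_fun setT (euclidean_dist x).
      exact: (measurableT_comp (@measurable_euclidean_dist R n) (measurable_pair1 x)).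
    have := m measurableT _ (measurable_itv `]-oo, rho[).
    by rewrite setTI set_itvNyo.
  rewrite sumrE big_ord3 mulrC in sump.
  have [lt0 lt1 lt2] : [/\ (p o0)^-1 < (r o0 o1 + r o0 o2) / n%:R,
      (p o1)^-1 < (r o0 o1 + r o1 o2) / n%:R &
      (p o2)^-1 < (r o0 o2 + r o1 o2) / n%:R].
    by rewrite -star0 -star1 -star2 ![_ / n%:R]mulrC.
  have [C C0 HC] := prod_Lnorm_le (@measurable_euclidean_dist R n)
    (@euclidean_distC R n) n_ge1 K0 ball_le r01p r02p r12p
    (p_gt0 o0) (p_gt0 o1) (p_gt0 o2) lt0 lt1 lt2 sump.
  exists C => f mf fp; rewrite normE supE.
  set g := (fun y => _); set S := ess_sup _ _.
  have S0 : (0 <= S)%E.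
    apply: ess_sup_gee; first exact: lebesgue_euclidean3_setT_gt0.
    by apply: nearW => y; rewrite lee_fin !mulr_ge0 ?powR_ge0.
  have [N [mN N0 gN]] : \forall y \ae lebesgue_euclidean3 R n, (g y <= S)%E.
    exact: ess_sup_ge.
  case: S S0 gN => [A| |] //; last by rewrite gt0_muley ?leey.
  rewrite lee_fin => A0 gN; rewrite -EFinM.
  apply: (HC _ _ _ N) => // y1 y2 y3 Ny.
  rewrite leNgt; apply/negP => Ag; apply: Ny; apply: gN => /=.
  by rewrite lee_fin /=; apply/negP; rewrite -ltNge.
Qed.
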